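(* Let $A$ be a locally $C^*$-algebra and let $E$ be a Hilbert $A$-module. Then: 1. If $E$ is countably generated, then $K_A(E)$ has a countable approximate unit. 2. If $A$ is a Fréchet locally $C^*$-algebra and if $K_A(E)$ has a countable approximate unit, then $E$ is countably generated.
   Context: A locally $C^*$-algebra is a complete Hausdorff complex topological $*$-algebra $A$ whose topology is determined by its continuous $C^*$-seminorms: a net $(a_i)$ converges to $0$ iff $p(a_i)\to 0$ for every continuous $C^*$-seminorm $p$. $S(A)$ denotes the set of all continuous $C^*$-seminorms on $A$. A Fréchet locally $C^*$-algebra is a locally $C^*$-algebra whose topology is determined by a countable family of $C^*$-seminorms. For $p\in S(A)$, $A_p=A/\ker p$, a $C^*$-algebra, with quotient map $\pi_p$. An approximate unit of a locally $C^*$-algebra $B$ is an increasing net $\{e_i\}_{i\in I}$ of positive elements of $B$ with $p(e_i)\le 1$ for all $i\in I$, $p\in S(B)$, and $p(be_i-b)\to 0$, $p(e_ib-b)\to 0$ for all $p\in S(B)$, $b\in B$. It is countable if it is indexed by a countable set (e.g. is a sequence). A pre-Hilbert $A$-module is a complex vector space $E$ that is also a right $A$-module (compatible with the complex algebra structure), with an $A$-valued inner product $\langle\cdot,\cdot\rangle:E\times E\to A$ that is $\mathbb{C}$- and $A$-linear in the second variable and satisfies $\langle\xi,\eta\rangle^*=\langle\eta,\xi\rangle$, $\langle\xi,\xi\rangle\ge 0$, and $\langle\xi,\xi\rangle=0$ iff $\xi=0$. It is a Hilbert $A$-module if it is complete for the topology given by the seminorms $\overline{p}_E(\xi)=\sqrt{p(\langle\xi,\xi\rangle)}$,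 $p\in S(A)$. A subset $G\subseteq E$ is a generating set for $E$ if the closed submodule of $E$ generated by $G$ is all of $E$; $E$ is countably generated if it has a countable generating set. $L_A(E)$ is the set of adjointable $A$-module homomorphisms $E\to E$. For $p\in S(A)$ let $\mathcal{E}_p=\{\xi\in E:p(\langle\xi,\xi\rangle)=0\}$ and $E_p=E/\mathcal{E}_p$, a Hilbert $A_p$-module with $\langle\xi+\mathcal{E}_p,\eta+\mathcal{E}_p\rangle=\pi_p(\langle\xi,\eta\rangle)$ and $(\xi+\mathcal{E}_p)\pi_p(a)=\xi a+\mathcal{E}_p$. Each $T\in L_A(E)$ induces $(\pi_p)_*(T)\in L_{A_p}(E_p)$ by $(\pi_p)_*(T)(\xi+\mathcal{E}_p)=T\xi+\mathcal{E}_p$. With the seminorms $\widetilde p(T)=\|(\pi_p)_*(T)\|$, $p\in S(A)$, $L_A(E)$ is a locally $C^*$-algebra. $K_A(E)$ (the ''compact'' operators) is the closure in $L_A(E)$ of the linear span of the operators $\theta_{\xi,\eta}$, $\theta_{\xi,\eta}(\zeta)=\xi\langle\eta,\zeta\rangle$, $\xi,\eta\in E$; it is a locally $C^*$-algebra. *)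

(* Defs.v *)
From HB Require Import structures.
From mathcomp Require Import all_boot all_order all_algebra.
From mathcomp Require Import complex.
From mathcomp Require Import all_classical all_reals all_analysis.

Set Implicit Arguments.
Unset Strict Implicit.
Unset Printing Implicit Defensive.

Import Order.TTheory GRing.Theory Num.Theory.
Import numFieldNormedType.Exports.

Local Open Scope classical_set_scope.
Local Open Scope complex_scope.
Local Open Scope ring_scope.

Reserved Notation "a ** b" (at level 40, left associativity).

(* Complex *-algebras are not assumed to be unital, hence cannot be based on the
   ring structures of the algebraic library. *)
HB.mixin Record Lmodule_isStarAlgebra (R : realType) A & GRing.Lmodule R[i] A := {
  amul : A -> A -> A ;
  astar : A -> A ;
  amulA : associative amul ;
  amulDl : left_distributive amul +%R ;
  amulDr : right_distributive amul +%R ;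
  amulZl : forall (c : R[i]) a b, amul (c *: a) b = c *: amul a b ;
  amulZr : forall (c : R[i]) a b, amul a (c *: b) = c *: amul a b ;
  astarK : involutive astar ;
  astarD : {morph astar : a b / a + b} ;
  astarZ : forall (c : R[i]) a, astar (c *: a) = c^* *: astar a ;
  astarM : forall a b, astar (amul a b) = amul (astar b) (astar a)
}.

#[short(type="starAlgType")]
HB.structure Definition StarAlgebra (R : realType) :=
  {A of GRing.Lmodule R[i] A & Lmodule_isStarAlgebra R A}.

Notation "a ** b" := (amul a b) : ring_scope.

(* A *-algebra and a topology, without any compatibility. *)
#[short(type="preTopologicalStarAlgType")]
HB.structure Definition PreTopologicalStarAlgebra (R : realType) :=
  {A of StarAlgebra R A & Topological A}.

Section StarSubalgebra.
Context {R : realType} {A : preTopologicalStarAlgType R}.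

(* In this section B is meant to be a *-subalgebra of A, with the induced
   operations and topology; B = setT gives the notions for A itself. *)
Implicit Types (B : set A) (p : A -> R).

Record cstar_seminorm B p : Prop := {
  cstar_seminormD : forall a b, B a -> B b -> p (a + b) <= p a + p b ;
  cstar_seminormZ : forall (c : R[i]) a, B a -> p (c *: a) = Normc.normc c * p a ;
  cstar_seminormM : forall a b, B a -> B b -> p (a ** b) <= p a * p b ;
  cstar_seminorm_star : forall a, B a -> p (astar a ** a) = p a ^+ 2
}.

Definition continuous_cstar_seminorms B : set (A -> R) :=
  [set p | cstar_seminorm B p /\ {within B, continuous p}].

Definition positive B (a : A) : Prop := exists2 b, B b & a = astar b ** b.

Definition directed (I : Type) (le : I -> I -> Prop) : Prop :=
  [/\ inhabited I, (forall i, le i i),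
      (forall i j k, le i j -> le j k -> le i k) &
      forall i j, exists k, le i k /\ le j k].

Definition tails (I : Type) (le : I -> I -> Prop) : set_system I :=
  filter_from setT (fun i => [set j | le i j]).

Record approximate_unit B (I : Type) (le : I -> I -> Prop) (e : I -> A) : Prop := {
  approximate_unit_directed : directed le ;
  approximate_unit_in : forall i, B (e i) ;
  approximate_unit_pos : forall i, positive B (e i) ;
  approximate_unit_incr : forall i j, le i j -> positive B (e j - e i) ;
  approximate_unit_le1 : forall p, continuous_cstar_seminorms B p ->
    forall i, p (e i) <= 1 ;
  approximate_unit_cvg : forall p b, continuous_cstar_seminorms B p -> B b ->
    (p (b ** e i - b) @[i --> tails le] --> (0 : R)) /\
    (p (e i ** b - b) @[i --> tails le] --> (0 : R))
}.

Definition has_countable_approximate_unit B : Prop :=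
  exists (I : Type) (le : I -> I -> Prop) (e : I -> A),
    countable [set: I] /\ approximate_unit B le e.

End StarSubalgebra.

(* Convergence to 0 of nets is rendered by convergence to 0 of filters. *)
Definition topology_given_by (R : realType) (V : topologicalLmodType R[i])
    (P : set (V -> R)) : Prop :=
  forall F : set_system V, Filter F ->
    (F --> (0 : V)) <-> (forall p, P p -> p x @[x --> F] --> (0 : R)).

(* Completeness for the additive uniform structure of V: F is a Cauchy filter
   iff x - y tends to 0 as x and y follow F. *)
Definition complete (R : realType) (V : topologicalLmodType R[i]) : Prop :=
  forall F : set_system V, ProperFilter F ->
    xy.1 - xy.2 @[xy --> (F, F)] --> (0 : V) -> exists x : V, F --> x.

HB.mixin Record isLocallyCstar (R : realType) A
    & StarAlgebra R A & TopologicalLmodule R[i] A := {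
  amul_continuous : continuous (fun ab : A * A => ab.1 ** ab.2) ;
  astar_continuous : continuous (@astar R A) ;
  locally_cstar_hausdorff : hausdorff_space A ;
  locally_cstar_complete : complete A ;
  locally_cstar_topology :
    topology_given_by (continuous_cstar_seminorms [set: A])
}.

#[short(type="locallyCstarType")]
HB.structure Definition LocallyCstar (R : realType) :=
  {A of StarAlgebra R A & TopologicalLmodule R[i] A & isLocallyCstar R A}.

Notation cstar_seminorms A := (continuous_cstar_seminorms [set: A]).

Definition frechet (R : realType) (A : locallyCstarType R) : Prop :=
  exists P : set (A -> R),
    [/\ countable P, P `<=` cstar_seminorms A & topology_given_by P].

HB.mixin Record Lmodule_isPreHilbert (R : realType) (A : locallyCstarType R) E
    & GRing.Lmodule R[i] E := {
  ract : E -> A -> E ;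
  inner : E -> E -> A ;
  ractDl : forall x y a, ract (x + y) a = ract x a + ract y a ;
  ractDr : forall x a b, ract x (a + b) = ract x a + ract x b ;
  ractM : forall x a b, ract x (a ** b) = ract (ract x a) b ;
  ractZl : forall (c : R[i]) x a, ract (c *: x) a = c *: ract x a ;
  ractZr : forall (c : R[i]) x a, ract x (c *: a) = c *: ract x a ;
  innerDr : forall x y z, inner x (y + z) = inner x y + inner x z ;
  innerZr : forall (c : R[i]) x y, inner x (c *: y) = c *: inner x y ;
  innerMr : forall x y a, inner x (ract y a) = inner x y ** a ;
  inner_star : forall x y, astar (inner x y) = inner y x ;
  inner_ge0 : forall x, positive setT (inner x x) ;
  inner_eq0 : forall x, inner x x = 0 <-> x = 0
}.

#[short(type="preHilbertModType")]
HB.structure Definition PreHilbertModule (R : realType) (A : locallyCstarType R) :=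
  {E of GRing.Lmodule R[i] E & Lmodule_isPreHilbert R A E}.

Section Seminorms.
Context {R : realType} {A : locallyCstarType R} {E : preHilbertModType A}.

Definition seminormE (p : A -> R) (x : E) : R := Num.sqrt (p (inner x x)).

Definition submodule (M : set E) : Prop :=
  [/\ M 0, (forall x y, M x -> M y -> M (x + y)),
      (forall (c : R[i]) x, M x -> M (c *: x)) &
      forall x a, M x -> M (ract x a)].

End Seminorms.

HB.mixin Record PreHilbert_isHilbert (R : realType) (A : locallyCstarType R) E
    & PreHilbertModule R A E & TopologicalLmodule R[i] E := {
  hilbert_topology : topology_given_by
    [set (seminormE p : E -> R) | p in cstar_seminorms A] ;
  hilbert_complete : complete E
}.

#[short(type="hilbertModType")]
HB.structure Definition HilbertModule (R : realType) (A : locallyCstarType R) :=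
  {E of PreHilbertModule R A E & TopologicalLmodule R[i] E & PreHilbert_isHilbert R A E}.

Section HilbertModuleTheory.
Context {R : realType} {A : locallyCstarType R} (E : hilbertModType A).

Definition generating (G : set E) : Prop :=
  smallest [set M : set E | submodule M /\ closed M] G = setT.

Definition countably_generated : Prop :=
  exists G : set E, countable G /\ generating G.

Definition adjointable (T : E -> E) : Prop :=
  [/\ (forall x y, T (x + y) = T x + T y),
      (forall (c : R[i]) x, T (c *: x) = c *: T x),
      (forall x a, T (ract x a) = ract (T x) a) &
      exists T' : E -> E, forall x y, inner (T x) y = inner x (T' y)].

Lemma inner0r (x : E) : inner x 0 = 0 :> A.
Proof. by rewrite -(scale0r (0 : E)) innerZr scale0r. Qed.

Lemma innerDl (x y z : E) : inner (x + y) z = inner x z + inner y z :> A.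
Proof. by rewrite -inner_star innerDr astarD !inner_star. Qed.

Lemma innerZl (c : R[i]) (x y : E) : inner (c *: x) y = c^*%R *: inner x y :> A.
Proof. by rewrite -inner_star innerZr astarZ inner_star. Qed.

Lemma innerMl (x y : E) (a : A) : inner (ract x a) y = astar a ** inner x y.
Proof. by rewrite -inner_star innerMr astarM inner_star. Qed.

Lemma inner_injl (x y : E) : (forall z, inner z x = inner z y :> A) -> x = y.
Proof.
move=> xy; apply/subr0_eq/(inner_eq0 (A := A)).
by rewrite -scaleN1r innerDr innerZr xy -innerZr -innerDr scaleN1r subrr inner0r.
Qed.

Definition adjointable_pred : pred (E -> E) := fun T => `[< adjointable T >].

Lemma adjointable_submod_closed : submod_closed adjointable_pred.
Proof.
split.
  apply/asboolP; split=> [x y|c x|x a|] /=.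
  - by rewrite /= addr0.
  - by rewrite scaler0.
  - apply: esym; apply: (addrI (ract 0 a)).
    by rewrite -ractDl !addr0.
  - exists (fun=> 0) => x y; rewrite inner0r -inner_star inner0r.
    by apply: (addrI (astar 0)); rewrite -astarD !addr0.
move=> c S T /asboolP[SD SZ SM [S' SS']] /asboolP[TD TZ TM [T' TT']].
apply/asboolP; split=> [x y|d x|x a|].
- by rewrite /= !fctE SD TD scalerDr addrACA.
- by rewrite !fctE SZ TZ scalerDr !scalerA mulrC.
- by rewrite !fctE SM TM ractDl ractZl.
- exists (fun y => c^*%R *: S' y + T' y) => x y.
  by rewrite !fctE innerDl innerZl SS' TT' innerDr innerZr.
Qed.

HB.instance Definition _ :=
  GRing.isSubmodClosed.Build _ _ adjointable_pred adjointable_submod_closed.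

Record operator := Operator { op : E -> E; opP : op \in adjointable_pred }.

HB.instance Definition _ := [isSub for op].
HB.instance Definition _ := [Choice of operator by <:].
HB.instance Definition _ := [SubChoice_isSubLmodule of operator by <:].

Lemma op_inj (S T : operator) : op S = op T -> S = T.
Proof. exact: val_inj. Qed.

Lemma operatorP (T : operator) : adjointable (op T).
Proof. exact/asboolP/(opP T). Qed.

Definition mk_operator (T : E -> E) (HT : adjointable T) : operator :=
  Operator (introT (asboolP _) HT : T \in adjointable_pred).

Lemma adjoint_ex (T : operator) :
  exists T' : E -> E, forall x y, inner (op T x) y = inner x (T' y) :> A.
Proof. by case: (operatorP T). Qed.

Definition adjoint_fun (T : operator) : E -> E := projT1 (cid (adjoint_ex T)).

Lemma adjoint_funP (T : operator) (x y : E) :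
  inner (op T x) y = inner x (adjoint_fun T y) :> A.
Proof. exact: (projT2 (cid (adjoint_ex T))). Qed.

Lemma adjoint_adjointable (T : operator) : adjointable (adjoint_fun T).
Proof.
split=> [x y|c x|x a|].
- by apply: inner_injl => z; rewrite innerDr -!adjoint_funP innerDr.
- by apply: inner_injl => z; rewrite innerZr -!adjoint_funP innerZr.
- by apply: inner_injl => z; rewrite innerMr -!adjoint_funP innerMr.
- exists (op T) => x y.
  by rewrite -inner_star -adjoint_funP inner_star.
Qed.

Definition adjoint (T : operator) : operator := mk_operator (adjoint_adjointable T).

Lemma comp_adjointable (S T : operator) : adjointable (op S \o op T).
Proof.
case: (operatorP S) (operatorP T) => SD SZ SM _ [TD TZ TM _].
split=> [x y|c x|x a|] /=; rewrite ?TD ?TZ ?TM //.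
by exists (adjoint_fun T \o adjoint_fun S) => x y /=; rewrite !adjoint_funP.
Qed.

Definition opcomp (S T : operator) : operator := mk_operator (comp_adjointable S T).

Lemma adjointP (T : operator) (x y : E) :
  inner (op T x) y = inner x (op (adjoint T) y) :> A.
Proof. exact: adjoint_funP. Qed.

Lemma adjoint_uniq (S T : operator) :
  (forall x y, inner (op T x) y = inner x (op S y) :> A) -> adjoint T = S.
Proof.
move=> ST; apply/op_inj/funext => y; apply: inner_injl => x.
by rewrite -adjointP ST.
Qed.

Fact opcompA : associative opcomp.
Proof. by move=> S T U; apply: op_inj. Qed.

Fact opcompDl : left_distributive opcomp +%R.
Proof. by move=> S T U; apply: op_inj. Qed.

Fact opcompDr : right_distributive opcomp +%R.
Proof.
move=> S T U; apply/op_inj/funext => x.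
by case: (operatorP S) => SD _ _ _; exact: SD.
Qed.

Fact opcompZl (c : R[i]) S T : opcomp (c *: S) T = c *: opcomp S T.
Proof. exact: op_inj. Qed.

Fact opcompZr (c : R[i]) S T : opcomp S (c *: T) = c *: opcomp S T.
Proof.
apply/op_inj/funext => x.
by case: (operatorP S) => _ SZ _ _; exact: SZ.
Qed.

Fact adjointK : involutive adjoint.
Proof.
by move=> T; apply: adjoint_uniq => x y; rewrite -inner_star -adjointP inner_star.
Qed.

Fact adjointD : {morph adjoint : S T / S + T}.
Proof.
by move=> S T; apply: adjoint_uniq => x y; rewrite innerDl !adjointP innerDr.
Qed.

Fact adjointZ (c : R[i]) T : adjoint (c *: T) = c^*%R *: adjoint T.
Proof. by apply: adjoint_uniq => x y; rewrite innerZl adjointP innerZr. Qed.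

Fact adjointM S T : adjoint (opcomp S T) = opcomp (adjoint T) (adjoint S).
Proof. by apply: adjoint_uniq => x y; rewrite /= -!adjointP. Qed.

HB.instance Definition _ := Lmodule_isStarAlgebra.Build R operator
  opcompA opcompDl opcompDr opcompZl opcompZr adjointK adjointD adjointZ adjointM.

(* The seminorm of the class of x in E_p is seminormE p x, so this is the
   operator norm of the map induced by T on E_p (which is bounded when p is a
   continuous C*-seminorm, so that the supremum is finite). *)
Definition opnorm (p : A -> R) (T : operator) : R :=
  sup [set seminormE p (op T x) | x in [set x : E | seminormE p x <= 1]].

(* The topology is generated by the open balls of the seminorms [opnorm p],
   [p] ranging over the continuous C*-seminorms. *)
Definition opballs : set (set operator) :=
  [set U | exists p (S : operator) (e : R), cstar_seminorms A p /\
    U = [set T | opnorm p (T - S) < e]].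

HB.instance Definition _ := isSubBaseTopological.Build operator opballs id.

Fact theta_adjointable (x y : E) : adjointable (fun z => ract x (inner y z)).
Proof.
split=> [z t|c z|z a|].
- by rewrite innerDr ractDr.
- by rewrite innerZr ractZr.
- by rewrite innerMr ractM.
- by exists (fun z => ract y (inner x z)) => z t; rewrite innerMl innerMr inner_star.
Qed.

Definition theta (x y : E) : operator := mk_operator (theta_adjointable x y).

Definition finite_rank : set operator :=
  [set T | exists (n : nat) (c : 'I_n -> R[i]) (x y : 'I_n -> E),
    T = \sum_(i < n) c i *: theta (x i) (y i)].

Definition compact_operators : set operator := closure finite_rank.

End HilbertModuleTheory.

Arguments finite_rank {R A} E.
Arguments compact_operators {R A} E.

(* Main.v *)
(* Idea. In a C*-algebra, b* b is positive (Kaplansky), and everything else about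
   positivity follows by approximating square roots with polynomials. This is
   done one seminorm p at a time, with "positive" meaning |t - a|_p <= t for some
   t >= 0; the unit is supplied by letting A act on itself. It yields the
   Cauchy-Schwarz inequality and monotonicity of p, hence order estimates for
   operators on any Hilbert module.

   Part 1. Let x_k be generators, h_n = n \sum_(k < n) theta_(x_k, x_k) and
   e_n = 1 - (1 + h_n)^-1 = h_n (1 + h_n)^-1. The e_n are of finite rank,
   0 <= e_n <= 1, they increase because inversion is antitone, and
   p((1 - e_n) x_k)^2 <= 1 / (4 n) because h (1 + h)^-2 <= 1/4; hence e_n x -> x
   for every x in E. The e_n and e_m - e_n are positive in K(E), their square
   roots being limits of polynomials in them without constant term.

   Part 2. Adjointable operators are bounded for every p, so [opnorm p] is a
   continuous C*-seminorm on K(E). Approximate each e_i by finite rank operators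
   in finitely many seminorms of a countable defining family, and let G consist of
   the countably many vectors involved. The closed submodule generated by G
   contains all e_i y, hence all z <z, y> = lim e_i (z <z, y>), hence
   z - (1 + t theta_(z, z))^-1 z, which converges to z as t grows. *)

Require Import Defs.
From HB Require Import structures.
From mathcomp Require Import all_boot all_order all_algebra.
From mathcomp Require Import complex finmap.
From mathcomp Require Import all_classical all_reals all_analysis.
From mathcomp Require Import ring lra.

Set Implicit Arguments.
Unset Strict Implicit.
Unset Printing Implicit Defensive.

Import Order.TTheory GRing.Theory Num.Theory.
Import numFieldNormedType.Exports.

Local Open Scope classical_set_scope.
Local Open Scope complex_scope.
Local Open Scope ring_scope.

(** The square root calculus needs the Cauchy-Schwarz inequality, and on a general Hilbert module
    that inequality needs positivity in [A]. The circle is broken by running the calculus first on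
    [selfmod A], where Cauchy-Schwarz is only submultiplicativity and the isometry of the
    involution. Fixing one seminorm avoids quotients and spectra: identities hold up to small
    errors. Exact limits occur only for resolvents and for square roots in K(E), where completeness
    of E supplies them.

    In Part 1 the unit is tested against arbitrary continuous C*-seminorms on K(E), not only against
    operator seminorms; everything about them has to come from continuity at 0 and the C*-identity.
    The h_n need not commute with each other, so monotonicity of e_n is an operator inequality
    rather than functional calculus.

    In Part 2 adjointable operators are not assumed continuous and E need not be metrizable when
    their boundedness is proved. Uniform boundedness is therefore run on vectors that are small for
    all seminorms at once, and resolvents of [theta x x] carry the bound to the whole of E. *)

Local Notation "r *~: x" := (r%:C *: x) (at level 40, left associativity).

(* Identities in abelian groups, decided by comparing the integer coefficients of
   the atoms; [ring] only applies to commutative rings. *)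
Inductive zexp := ZVar of nat | ZAdd of zexp & zexp | ZOpp of zexp | ZZero.

Fixpoint zcoef e i : int :=
  match e with
  | ZVar j => if i == j then 1 else 0
  | ZAdd e1 e2 => zcoef e1 i + zcoef e2 i
  | ZOpp e1 => - zcoef e1 i
  | ZZero => 0
  end.

Section AbelianGroupExpressions.
Context {V : zmodType}.

Fixpoint zval (env : seq V) e : V :=
  match e with
  | ZVar j => env`_j
  | ZAdd e1 e2 => zval env e1 + zval env e2
  | ZOpp e1 => - zval env e1
  | ZZero => 0
  end.

Lemma zvalE env e : zval env e = \sum_(i < size env) env`_i *~ zcoef e i.
Proof.
elim: e => [j|e1 IH1 e2 IH2|e1 IH|] /=.
- have [js|sj] := ltnP j (size env).
    rewrite (bigD1 (Ordinal js))//= eqxx mulr1z big1 ?addr0// => i ij.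
    by rewrite ifF ?mulr0z//; apply/negbTE; move: ij; rewrite -val_eqE.
  rewrite nth_default// big1// => i _; rewrite ifF ?mulr0z//.
  by apply/negbTE; rewrite neq_ltn (leq_trans (ltn_ord i)).
- by rewrite IH1 IH2 -big_split/=; apply: eq_bigr => i _; rewrite mulrzDr.
- by rewrite IH -sumrN; apply: eq_bigr => i _; rewrite mulrNz.
- by rewrite big1// => i _; rewrite mulr0z.
Qed.

Lemma zval_eq env e1 e2 :
  all (fun i => zcoef e1 i == zcoef e2 i) (iota 0 (size env)) -> zval env e1 = zval env e2.
Proof.
move=> /allP H; rewrite !zvalE; apply: eq_bigr => i _; congr (_ *~ _).
by apply/eqP/H; rewrite mem_iota/=.
Qed.

End AbelianGroupExpressions.

Ltac zlookup x env :=
  lazymatch env with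
  | x :: _ => constr:(Some 0%N)
  | _ :: ?env' =>
    lazymatch zlookup x env' with
    | Some ?n => constr:(Some n.+1)
    | None => constr:(@None nat)
    end
  | _ => constr:(@None nat)
  end.

Ltac zatoms e env :=
  lazymatch e with
  | (?a + ?b)%R => let env1 := zatoms a env in zatoms b env1
  | (- ?a)%R => zatoms a env
  | 0%R => env
  | ?a => lazymatch zlookup a env with
          | Some _ => env
          | None => constr:(a :: env)
          end
  end.

Ltac zreify e env :=
  lazymatch e with
  | (?a + ?b)%R => let a' := zreify a env in let b' := zreify b env in constr:(ZAdd a' b')
  | (- ?a)%R => let a' := zreify a env in constr:(ZOpp a')
  | 0%R => constr:(ZZero)
  | ?a => lazymatch zlookup a env with Some ?n => constr:(ZVar n) end
  end.

Ltac abelian :=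
  lazymatch goal with
  | |- @eq ?T ?a ?b =>
    let env0 := zatoms a (@nil T) in
    let env := zatoms b env0 in
    let a' := zreify a env in
    let b' := zreify b env in
    exact: (@zval_eq _ env a' b' isT)
  end.

Lemma conjCR (R : realType) (r : R) : (r%:C)^*%R = r%:C :> R[i].
Proof. exact: conjc_real. Qed.

Lemma normcR (R : realType) (r : R) : Normc.normc (r%:C) = `|r|.
Proof. by rewrite /= expr0n addr0 sqrtr_sqr. Qed.

(** * Seminorms and adjointable operators *)

Section StarAlgebraTheory.
Context {R : realType} {A : starAlgType R}.
Implicit Types a b : A.

Lemma amul0r a : 0 ** a = 0.
Proof. by have := amulZl 0 a a; rewrite !scale0r. Qed.

Lemma amulr0 a : a ** 0 = 0.
Proof. by have := amulZr 0 a a; rewrite !scale0r. Qed.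

Lemma amulNl a b : (- a) ** b = - (a ** b).
Proof. by rewrite -scaleN1r amulZl scaleN1r. Qed.

Lemma amulNr a b : a ** (- b) = - (a ** b).
Proof. by rewrite -scaleN1r amulZr scaleN1r. Qed.

Lemma amulBl a b c : (a - b) ** c = a ** c - b ** c.
Proof. by rewrite amulDl amulNl. Qed.

Lemma amulBr a b c : a ** (b - c) = a ** b - a ** c.
Proof. by rewrite amulDr amulNr. Qed.

Lemma astar0 : astar (0 : A) = 0.
Proof. by have := astarZ 0 (0 : A); rewrite conjC0 !scale0r. Qed.

Lemma astarN a : astar (- a) = - astar a.
Proof. by apply/esym/(addrI (astar a)); rewrite -astarD !subrr astar0. Qed.

Lemma astarB a b : astar (a - b) = astar a - astar b.
Proof. by rewrite astarD astarN. Qed.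

Lemma astarZR (r : R) a : astar (r *~: a) = r *~: astar a.
Proof. by rewrite astarZ conjCR. Qed.

End StarAlgebraTheory.

Section Seminorm.
Context {R : realType} {A : preTopologicalStarAlgType R}.
Context {B : set A} {p : A -> R} (pP : cstar_seminorm B p).
Hypothesis BN : forall a, B a -> B (- a).

Lemma cstar_seminormN a : B a -> p (- a) = p a.
Proof. by move=> Ba; rewrite -scaleN1r (cstar_seminormZ pP)// normcN Normc.normc1 mul1r. Qed.

Lemma cstar_seminorm0 a : B a -> p 0 = 0.
Proof. by move=> Ba; rewrite -(scale0r a) (cstar_seminormZ pP)// Normc.normc0 mul0r. Qed.

Lemma cstar_seminorm_ge0 a : B a -> 0 <= p a.
Proof.
move=> Ba; have := cstar_seminormD pP Ba (BN Ba).
by rewrite subrr (cstar_seminorm0 Ba) cstar_seminormN// -mulr2n pmulrn_lge0.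
Qed.

Lemma cstar_seminormZR (r : R) a : B a -> p (r *~: a) = `|r| * p a.
Proof. by move=> Ba; rewrite (cstar_seminormZ pP)// normcR. Qed.

Lemma cstar_seminormB a b : B a -> B b -> p (a - b) <= p a + p b.
Proof.
by move=> Ba Bb; rewrite -(cstar_seminormN Bb); apply: (cstar_seminormD pP) => //; exact: BN.
Qed.

Hypothesis Bstar : forall a, B a -> B (astar a).

Lemma cstar_seminorm_astar a : B a -> p (astar a) = p a.
Proof.
suff H b : B b -> p b <= p (astar b).
  by move=> Ba; apply/eqP; rewrite eq_le H// andbT -{2}(astarK a) H//; exact: Bstar.
move=> Bb; have [->|/eqP pb] := eqVneq (p b) 0.
  by apply: cstar_seminorm_ge0; exact: Bstar.
have pb0 : 0 < p b by rewrite lt_neqAle cstar_seminorm_ge0// andbT eq_sym; exact/eqP.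
rewrite -(ler_pM2r pb0) -expr2 -(cstar_seminorm_star pP)//.
by apply: (cstar_seminormM pP) => //; exact: Bstar.
Qed.

End Seminorm.

(* A acting on itself: its adjointable operators contain both the left
   multiplications by A and the identity, so they serve as a unitization. *)
Definition selfmod (R : realType) (A : locallyCstarType R) : Type := A.

Section SelfModule.
Context {R : realType} (A : locallyCstarType R).
HB.instance Definition _ := TopologicalLmodule.on (selfmod A).

(** When all seminorms vanish at [a], the principal filter at [a] converges to 0, so Hausdorff
    separation identifies the two points. *)
Lemma locally_cstar_sep (a : A) : (forall p, cstar_seminorms A p -> p a = 0) -> a = 0.
Proof.
move=> pa0; apply/esym/(@locally_cstar_hausdorff R A) => U V U0 Va.
pose F : set_system A := [set W | W a].
have FF : Filter F by split=> // P Q PQ Pa; exact: PQ.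
have /(_ _ U0) Ua : F --> (0 : A).
  apply/(@locally_cstar_topology R A F FF) => p pA W /= W0.
  by rewrite /F/= /nbhs/= pa0//; exact: nbhs_singleton.
by exists a; split=> //; exact: nbhs_singleton.
Qed.

Lemma cstar_seminorm_eq0 (a : A) p : cstar_seminorm setT p -> p (astar a ** a) = 0 -> p a = 0.
Proof.
by move=> pP /eqP; rewrite (cstar_seminorm_star pP)// expf_eq0/= => /eqP.
Qed.

Fact selfmod_inner_eq0 (x : A) : astar x ** x = 0 <-> x = 0.
Proof.
split=> [xx|->]; last by rewrite amulr0.
apply: locally_cstar_sep => p [pP _]; apply: (cstar_seminorm_eq0 pP).
by rewrite xx (@cstar_seminorm0 _ _ _ _ pP 0).
Qed.

Fact selfmod_inner_star (x y : A) : astar (astar x ** y) = astar y ** x.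
Proof. by rewrite astarM astarK. Qed.

Fact selfmod_inner_ge0 (x : A) : Defs.positive setT (astar x ** x).
Proof. by exists x. Qed.

HB.instance Definition _ := @Lmodule_isPreHilbert.Build R A (selfmod A)
  (fun x a : A => x ** a) (fun x y : A => astar x ** y)
  (fun x y a : A => amulDl x y a) (fun x y a : A => amulDr x y a)
  (fun x y a : A => amulA x y a) (fun c (x y : A) => amulZl c x y)
  (fun c (x y : A) => amulZr c x y)
  (fun x y z : A => amulDr (astar x) y z)
  (fun c (x y : A) => amulZr c (astar x) y)
  (fun x y z : A => amulA (astar x) y z)
  selfmod_inner_star selfmod_inner_ge0 selfmod_inner_eq0.

Lemma selfmod_seminormE p (x : selfmod A) : cstar_seminorm setT p ->
  seminormE p x = p x.
Proof.
move=> pP; rewrite /seminormE /inner/= (cstar_seminorm_star pP)// sqrtr_sqr ger0_norm//.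
exact: (cstar_seminorm_ge0 pP).
Qed.

Fact selfmod_topology : topology_given_by
    [set (seminormE p : selfmod A -> R) | p in cstar_seminorms A].
Proof.
suff -> : [set (seminormE p : selfmod A -> R) | p in cstar_seminorms A] =
  cstar_seminorms A by exact: locally_cstar_topology.
have selfE p : cstar_seminorm setT p -> (seminormE p : selfmod A -> R) = p.
  by move=> pP; apply/funext => x; exact: selfmod_seminormE.
rewrite eqEsubset; split=> [_ [p [pP pc] <-]|p [pP pc]].
  by rewrite selfE.
by exists p => //; exact: selfE.
Qed.

HB.instance Definition _ := @PreHilbert_isHilbert.Build R A (selfmod A)
  selfmod_topology (@locally_cstar_complete R A).

End SelfModule.

Section SeminormT.
Context {R : realType} {A : preTopologicalStarAlgType R}.
Context {p : A -> R} (pP : cstar_seminorm [set: A] p).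
Implicit Types a b : A.

Let NT a : [set: A] a -> [set: A] (- a). Proof. by []. Qed.
Let ST a : [set: A] a -> [set: A] (astar a). Proof. by []. Qed.

Lemma cstarD a b : p (a + b) <= p a + p b. Proof. exact: (cstar_seminormD pP). Qed.
Lemma cstarM a b : p (a ** b) <= p a * p b. Proof. exact: (cstar_seminormM pP). Qed.
Lemma cstar_sqr a : p (astar a ** a) = p a ^+ 2. Proof. exact: (cstar_seminorm_star pP). Qed.
Lemma cstarN a : p (- a) = p a. Proof. exact: (cstar_seminormN pP). Qed.
Lemma cstar0 : p 0 = 0. Proof. exact: (@cstar_seminorm0 _ _ _ _ pP 0). Qed.
Lemma cstar_ge0 a : 0 <= p a. Proof. exact: (cstar_seminorm_ge0 pP NT). Qed.
Lemma cstarZ (c : R[i]) a : p (c *: a) = Normc.normc c * p a.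
Proof. exact: (cstar_seminormZ pP). Qed.
Lemma cstarZR (r : R) a : p (r *~: a) = `|r| * p a. Proof. exact: (cstar_seminormZR pP). Qed.
Lemma cstarB a b : p (a - b) <= p a + p b. Proof. exact: (cstar_seminormB pP NT). Qed.
Lemma cstar_astar a : p (astar a) = p a. Proof. exact: (cstar_seminorm_astar pP NT ST). Qed.

End SeminormT.

Section InnerTheory.
Context {R : realType} {A : locallyCstarType R} {E : hilbertModType A}.
Implicit Types (x y z : E) (S T : operator E).

Lemma innerNr x y : inner x (- y) = - inner x y :> A.
Proof. by rewrite -scaleN1r innerZr scaleN1r. Qed.

Lemma innerNl x y : inner (- x) y = - inner x y :> A.
Proof. by rewrite -inner_star innerNr astarN inner_star. Qed.

Lemma innerBr x y z : inner x (y - z) = inner x y - inner x z :> A.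
Proof. by rewrite innerDr innerNr. Qed.

Lemma innerBl x y z : inner (x - y) z = inner x z - inner y z :> A.
Proof. by rewrite innerDl innerNl. Qed.

Lemma innerZRl (r : R) x y : inner (r *~: x) y = r *~: inner x y :> A.
Proof. by rewrite innerZl conjCR. Qed.

Lemma opD T x y : op T (x + y) = op T x + op T y.
Proof. by case: (operatorP T). Qed.

Lemma opZ T (c : R[i]) x : op T (c *: x) = c *: op T x.
Proof. by case: (operatorP T). Qed.

Lemma op_ract T x (a : A) : op T (ract x a) = ract (op T x) a.
Proof. by case: (operatorP T). Qed.

Lemma opN T x : op T (- x) = - op T x.
Proof. by rewrite -scaleN1r opZ scaleN1r. Qed.

Lemma opB T x y : op T (x - y) = op T x - op T y.
Proof. by rewrite opD opN. Qed.

Lemma op0 T : op T 0 = 0.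
Proof. by have := opZ T 0 0; rewrite !scale0r. Qed.

Lemma opadd S T x : op (S + T) x = op S x + op T x. Proof. by []. Qed.
Lemma opopp T x : op (- T) x = - op T x. Proof. by []. Qed.
Lemma opscale (c : R[i]) T x : op (c *: T) x = c *: op T x. Proof. by []. Qed.
Lemma opmul S T x : op (S ** T) x = op S (op T x). Proof. by []. Qed.
Lemma opzero x : op (0 : operator E) x = 0. Proof. by []. Qed.

Lemma opsum (I : Type) (r : seq I) (P : pred I) (F : I -> operator E) x :
  op (\sum_(i <- r | P i) F i) x = \sum_(i <- r | P i) op (F i) x.
Proof. by elim/big_rec2: _ => // i y T _ <-. Qed.

Definition operatorE := (opadd, opopp, opscale, opmul, opzero).

Lemma operator_eq S T : (forall x, op S x = op T x) -> S = T.
Proof. by move=> ST; apply/op_inj/funext. Qed.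

Lemma inner_opl T x y : inner (op T x) y = inner x (op (astar T) y) :> A.
Proof. exact: adjointP. Qed.

Lemma inner_opr T x y : inner x (op T y) = inner (op (astar T) x) y :> A.
Proof. by rewrite inner_opl astarK. Qed.

Lemma id_adjointable : adjointable (@id E).
Proof. by split=> //; exists id. Qed.

Definition idop : operator E := mk_operator id_adjointable.

Lemma opid x : op idop x = x. Proof. by []. Qed.

Lemma astar_idop : astar idop = idop.
Proof. by apply: adjoint_uniq. Qed.

Lemma amul1o T : idop ** T = T. Proof. exact: op_inj. Qed.

Lemma amulo1 T : T ** idop = T. Proof. exact: op_inj. Qed.

End InnerTheory.

Arguments idop {R A} E.

Section Bounds.
Context {R : realType} {A : locallyCstarType R} {E : hilbertModType A}.
Context {p : A -> R} (pP : cstar_seminorm [set: A] p).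
Implicit Types (x y z : E) (S T : operator E).

(** Kept as a hypothesis: it is immediate for [selfmod A], and the general case is deduced from
    positivity obtained there. *)
Definition cauchy_schwarz := forall x y : E, p (inner x y) <= seminormE p x * seminormE p y.

Lemma seminormE_ge0 x : 0 <= seminormE p x. Proof. exact: sqrtr_ge0. Qed.

Lemma seminormE_sqr x : seminormE p x ^+ 2 = p (inner x x).
Proof. by rewrite sqr_sqrtr// (cstar_ge0 pP). Qed.

Lemma seminormE0 : seminormE p (0 : E) = 0.
Proof. by rewrite /seminormE inner0r (cstar0 pP) sqrtr0. Qed.

Lemma seminormE_le x c : 0 <= c -> p (inner x x) <= c ^+ 2 -> seminormE p x <= c.
Proof. by move=> c0 xc; rewrite -(ler_pXn2r (n := 2))// ?nnegrE ?seminormE_ge0// seminormE_sqr. Qed.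

Lemma seminormEZ (c : R[i]) x : seminormE p (c *: x) = Normc.normc c * seminormE p x.
Proof.
rewrite /seminormE innerZr innerZl !(cstarZ pP).
have nc : Normc.normc (c^*%R) = Normc.normc c.
  by case: c => a b /=; rewrite sqrrN.
rewrite nc mulrA -expr2 sqrtrM ?sqr_ge0// sqrtr_sqr ger0_norm//.
by case: c {nc} => a b /=; exact: sqrtr_ge0.
Qed.

Lemma seminormEZR (r : R) x : seminormE p (r *~: x) = `|r| * seminormE p x.
Proof. by rewrite seminormEZ normcR. Qed.

Lemma seminormEN x : seminormE p (- x) = seminormE p x.
Proof. by rewrite -scaleN1r seminormEZ normcN Normc.normc1 mul1r. Qed.

Lemma seminormE_ract x (a : A) : seminormE p (ract x a) <= seminormE p x * p a.
Proof.
apply: seminormE_le; first by rewrite mulr_ge0 ?seminormE_ge0 ?(cstar_ge0 pP).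
rewrite innerMr innerMl exprMn seminormE_sqr.
apply: (le_trans (cstarM pP _ _)); rewrite expr2 mulrA ler_wpM2r ?(cstar_ge0 pP)//.
by apply: (le_trans (cstarM pP _ _)); rewrite (cstar_astar pP) mulrC.
Qed.

Hypothesis CS : cauchy_schwarz.

Lemma seminormED x y : seminormE p (x + y) <= seminormE p x + seminormE p y.
Proof.
apply: seminormE_le; first by rewrite addr_ge0 ?seminormE_ge0.
rewrite innerDr !innerDl sqrrD !seminormE_sqr.
have h1 := cstarD pP (inner x x + inner y x) (inner x y + inner y y).
have h2 := cstarD pP (inner x x) (inner y x).
have h3 := cstarD pP (inner x y) (inner y y).
have h4 := CS x y; have h5 := CS y x.
by lra.
Qed.

Lemma seminormEB x y : seminormE p (x - y) <= seminormE p x + seminormE p y.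
Proof. by rewrite -(seminormEN y) seminormED. Qed.

Lemma seminormE_dist x y : `|seminormE p x - seminormE p y| <= seminormE p (x - y).
Proof.
rewrite ler_norml; apply/andP; split.
  by have := seminormED (y - x) x; rewrite subrK -opprB seminormEN; lra.
by have := seminormED (x - y) y; rewrite subrK; lra.
Qed.

(** Bounds are carried as explicit constants because [opnorm p] is a meaningful supremum only once
    adjointable operators are known to be bounded. *)
Definition bnd T c := forall x, seminormE p (op T x) <= c * seminormE p x.

Lemma bnd_le T c d : c <= d -> bnd T c -> bnd T d.
Proof. by move=> cd Tc x; apply: (le_trans (Tc x)); rewrite ler_wpM2r ?seminormE_ge0. Qed.

Lemma bndD S T c d : bnd S c -> bnd T d -> bnd (S + T) (c + d).
Proof.
move=> Sc Td x; rewrite operatorE mulrDl; apply: (le_trans (seminormED _ _)).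
by apply: lerD.
Qed.

Lemma bndM S T c d : 0 <= c -> bnd S c -> bnd T d -> bnd (S ** T) (c * d).
Proof.
move=> c0 Sc Td x; rewrite operatorE -mulrA; apply: (le_trans (Sc _)).
by rewrite ler_wpM2l.
Qed.

Lemma bndZ T (k : R[i]) c : bnd T c -> bnd (k *: T) (Normc.normc k * c).
Proof.
move=> Tc x; rewrite operatorE seminormEZ -mulrA ler_wpM2l//.
by case: k => a b /=; exact: sqrtr_ge0.
Qed.

Lemma bndZR T (r c : R) : bnd T c -> bnd (r *~: T) (`|r| * c).
Proof. by rewrite -normcR; exact: bndZ. Qed.

Lemma bndN T c : bnd T c -> bnd (- T) c.
Proof. by move=> Tc x; rewrite operatorE seminormEN. Qed.

Lemma bndB S T c d : bnd S c -> bnd T d -> bnd (S - T) (c + d).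
Proof. by move=> Sc Td; apply: bndD => //; exact: bndN. Qed.

Lemma bnd_id : bnd (idop E) 1.
Proof. by move=> x; rewrite mul1r. Qed.

Lemma bnd0 c : 0 <= c -> bnd 0 c.
Proof. by move=> c0 x; rewrite operatorE seminormE0 mulr_ge0 ?seminormE_ge0. Qed.

Lemma bnd_idZ (r : R) : 0 <= r -> bnd (r *~: idop E) r.
Proof. by move=> r0; have := bndZR r bnd_id; rewrite mulr1 ger0_norm. Qed.

Lemma bnd_star T c : 0 <= c -> bnd T c -> bnd (astar T) c.
Proof.
move=> c0 Tc x; have [->|nx0] := eqVneq (seminormE p (op (astar T) x)) 0.
  by rewrite mulr_ge0 ?seminormE_ge0.
have np : 0 < seminormE p (op (astar T) x) by rewrite lt_neqAle eq_sym nx0 seminormE_ge0.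
rewrite -(ler_pM2r np) -expr2 seminormE_sqr inner_opl astarK.
by apply: (le_trans (CS _ _)); rewrite mulrAC mulrC ler_wpM2r ?seminormE_ge0.
Qed.

(** The operator form of the C*-identity: Cauchy-Schwarz applied to <x, T* T x>, which is <T x, T
    x>. *)
Lemma bnd_cstar T c : 0 <= c -> bnd (astar T ** T) (c ^+ 2) -> bnd T c.
Proof.
move=> c0 Tc x; apply: seminormE_le; first by rewrite mulr_ge0 ?seminormE_ge0.
rewrite inner_opl; apply: (le_trans (CS _ _)).
rewrite exprMn [X in _ <= _ * X]expr2 mulrCA ler_wpM2l ?seminormE_ge0//.
exact: Tc.
Qed.

Lemma bnd_sa T c : 0 <= c -> astar T = T -> bnd (T ** T) (c ^+ 2) -> bnd T c.
Proof. by move=> c0 Ts TT; apply: bnd_cstar; rewrite ?Ts. Qed.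

Lemma bnd_closed T c : (forall e, 0 < e -> bnd T (c + e)) -> bnd T c.
Proof.
move=> Tc x; apply/ler_addgt0Pr => e e0.
have n1 : 0 < 1 + seminormE p x by have := seminormE_ge0 x; lra.
apply: (le_trans (Tc _ (divr_gt0 e0 n1) x)); rewrite mulrDl lerD2l.
rewrite mulrAC ler_pdivrMr// ler_wpM2l ?(ltW e0)//; lra.
Qed.

End Bounds.

Arguments bnd {R A E} p T c.
Arguments cauchy_schwarz {R A} E p.

(** * Positivity in C*-algebras *)

Section PolynomialCalculus.
Context {R : realType} {A : locallyCstarType R} {E : hilbertModType A}.
Implicit Types (T a : operator E) (f g : {poly R}).

Fixpoint opexp T n : operator E := if n is m.+1 then T ** opexp T m else idop E.

(** Real coefficients keep the value self-adjoint whenever [T] is. *)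
Definition ev T f : operator E := \sum_(i < size f) f`_i *~: opexp T i.

Lemma ev_widen T f n : (size f <= n)%N -> ev T f = \sum_(i < n) f`_i *~: opexp T i.
Proof.
move=> fn; rewrite /ev (big_ord_widen n (fun i => f`_i *~: opexp T i))// big_mkcond/=.
by apply: eq_bigr => i _; case: ltnP => // fi; rewrite nth_default// scale0r.
Qed.

Lemma evD T f g : ev T (f + g) = ev T f + ev T g.
Proof.
set n := maxn (size f) (size g).
rewrite !(@ev_widen _ _ n) ?leq_maxl ?leq_maxr ?size_polyD// -big_split/=.
by apply: eq_bigr => i _; rewrite coefD rmorphD/= scalerDl.
Qed.

Lemma evZ T (c : R) f : ev T (c *: f) = c *~: ev T f.
Proof.
rewrite !(@ev_widen _ _ (size f)) ?size_scale_leq// scaler_sumr.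
by apply: eq_bigr => i _; rewrite coefZ rmorphM/= scalerA.
Qed.

Lemma ev0 T : ev T 0 = 0. Proof. by rewrite /ev size_poly0 big_ord0. Qed.

Lemma evN T f : ev T (- f) = - ev T f.
Proof. by rewrite -scaleN1r evZ rmorphN1 scaleN1r. Qed.

Lemma evB T f g : ev T (f - g) = ev T f - ev T g.
Proof. by rewrite evD evN. Qed.

Lemma ev1 T : ev T 1 = idop E.
Proof. by rewrite /ev size_poly1 big_ord1 coef1 scale1r. Qed.

Lemma evC T (c : R) : ev T c%:P = c *~: idop E.
Proof. by rewrite -[c%:P]mulr1 mul_polyC evZ ev1. Qed.

Lemma evMX T f : ev T (f * 'X) = T ** ev T f.
Proof.
rewrite (@ev_widen _ _ (size f).+1); last first.
  by rewrite (leq_trans (size_polyMleq _ _))// size_polyX addn2.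
rewrite big_ord_recl coefMX eqxx scale0r add0r (big_morph _ (amulDr T) (amulr0 T)).
by apply: eq_bigr => i _; rewrite coefMX/= amulZr.
Qed.

Lemma evX T : ev T 'X = T.
Proof. by rewrite -[ 'X ]mul1r evMX ev1 amulo1. Qed.

Lemma evM T f g : ev T (f * g) = ev T f ** ev T g.
Proof.
elim/poly_ind: f => [|f c IH]; first by rewrite mul0r ev0 amul0r.
rewrite mulrDl mul_polyC mulrAC !evD !evMX evZ evC IH amulDl amulZl amul1o.
by rewrite amulA.
Qed.

Lemma ev_sqr T f : ev T (f ^+ 2) = ev T f ** ev T f.
Proof. by rewrite expr2 evM. Qed.

Lemma ev_comm T f g : ev T f ** ev T g = ev T g ** ev T f.
Proof. by rewrite -!evM mulrC. Qed.

Lemma ev_star T f : astar T = T -> astar (ev T f) = ev T f.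
Proof.
move=> Ts; elim/poly_ind: f => [|f c IH]; first by rewrite ev0 astar0.
rewrite evD evC astarD astarZR astar_idop; congr (_ + _).
by rewrite {1}evMX mulrC mulrC evM evX astarM Ts IH.
Qed.

End PolynomialCalculus.

(** * Approximate square roots and the positive cone of one seminorm *)

Section SquareRoot.
Context {R : realType} {A : locallyCstarType R} {E : hilbertModType A}.
Context {p : A -> R} (pP : cstar_seminorm [set: A] p) (CS : cauchy_schwarz E p).
Implicit Types (T a : operator E) (f g W : {poly R}) (d e k r t : R).

Local Notation bnd := (@bnd R A E p).

(* Visser's iteration: the limit Y satisfies (1 - Y)^2 = 1 - W; [sqt] is the
   scalar case W = 1, which dominates the general one. *)
Fixpoint sqiter W n : {poly R} :=
  if n is m.+1 then 2^-1 *: (W + sqiter W m ^+ 2) else 0.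

Fixpoint sqt n : R := if n is m.+1 then (1 + sqt m ^+ 2) / 2 else 0.

Lemma sqt_ge0 n : 0 <= sqt n.
Proof. by case: n => //= n; rewrite divr_ge0// addr_ge0// sqr_ge0. Qed.

(** The gap s = 1 - [sqt n] obeys s' = s - s^2 / 2, an increasing map on [0, 1] that sends 2 / m
    below 2 / (m + 1). *)
Lemma sqt_bound n : 0 <= 1 - sqt n <= 2 / n.+2%:R.
Proof.
elim: n => [|n /andP[s0 s1]]; first by rewrite /= subr0 ler01 /= divff ?lexx ?pnatr_eq0.
set s := 1 - sqt n in s0 s1 *.
have -> : 1 - sqt n.+1 = s - s ^+ 2 / 2 by rewrite /s/=; field.
have st : s <= 1 by rewrite /s; have := sqt_ge0 n; lra.
apply/andP; split; first by nra.
have n2 : (0 : R) < n.+2%:R by rewrite ltr0n.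
have n3 : (0 : R) < n.+3%:R by rewrite ltr0n.
set u := 2 / n.+2%:R in s1 *.
have u1 : u <= 1 by rewrite /u ler_pdivrMr// mul1r ler_nat.
apply: (@le_trans _ _ (u - u ^+ 2 / 2)); first by nra.
have n1 : (0 : R) <= n%:R by rewrite ler0n.
rewrite /u ler_pdivlMr// -subr_ge0.
have -> : n.+3%:R = n.+2%:R + 1 :> R by rewrite -natr1.
set m := n.+2%:R in n2 *.
have -> : 2 - (2 / m - (2 / m) ^+ 2 / 2) * (m + 1) = 2 / m ^+ 2 by field; rewrite gt_eqF.
by rewrite divr_ge0// sqr_ge0.
Qed.

Lemma sqt_le1 n : sqt n <= 1.
Proof. by have /andP[] := sqt_bound n; lra. Qed.

Lemma sqtS n : sqt n.+1 - sqt n = (1 - sqt n) ^+ 2 / 2.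
Proof. by rewrite /=; field. Qed.

Lemma sqt_cvg e : 0 < e -> exists n, forall m, (n <= m)%N -> 1 - sqt m < e.
Proof.
move=> e0; exists (Num.truncn (2 / e)) => m nm.
have /andP[_ /le_lt_trans] := sqt_bound m; apply.
rewrite ltr_pdivrMr ?ltr0n// mulrC -ltr_pdivrMr//.
apply: (lt_le_trans (truncnS_gt _)).
by rewrite ler_nat (leq_trans _ (leqnSn _)).
Qed.

(** The recursion rewrites Y_n^2 as 2 Y_(n+1) - W, so the error of 1 - Y_n as a square root is twice
    the next increment. *)
Lemma sqiter_sqr W n :
  (1 - sqiter W n) ^+ 2 = 1 - W + 2 *: (sqiter W n.+1 - sqiter W n).
Proof.
rewrite /= scalerBr scalerA mulfV ?pnatr_eq0// scale1r.
by rewrite -[2 *: _]/((1 + 1) *: _) scalerDl scale1r; ring.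
Qed.

Lemma bnd_sqiter a W n : bnd (ev a W) 1 -> bnd (ev a (sqiter W n)) (sqt n).
Proof.
move=> W1; elim: n => [|n IH] /=; first by rewrite ev0; apply: (bnd0 pP).
rewrite evZ evD ev_sqr mulrC -[2^-1 in X in bnd _ X]ger0_norm//.
apply: (bndZR pP); apply: (bndD pP CS) => //; rewrite expr2.
exact: (bndM (sqt_ge0 _)).
Qed.

(** Increments of the iteration satisfy D_(n+1) = D_n (Y_(n+1) + Y_n) / 2, and those of [sqt]
    satisfy the same recursion, so domination propagates. *)
Lemma bnd_sqiterS a W n : bnd (ev a W) 1 ->
  bnd (ev a (sqiter W n.+1 - sqiter W n)) (sqt n.+1 - sqt n).
Proof.
move=> W1; elim: n => [|n IH].
  rewrite /= !subr0 expr0n/= addr0 expr0n/= addr0 evZ mul1r -[2^-1 in X in bnd _ X]ger0_norm//.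
  by rewrite -[X in bnd _ X]mulr1; exact: (bndZR pP).
have -> : sqiter W n.+2 - sqiter W n.+1 =
    2^-1 *: ((sqiter W n.+1 - sqiter W n) * (sqiter W n.+1 + sqiter W n)).
  by rewrite mulrC mulrC -subr_sqr /= -scalerBr opprD addrACA subrr add0r.
have -> : sqt n.+2 - sqt n.+1 =
    2^-1 * ((sqt n.+1 - sqt n) * (sqt n.+1 + sqt n)).
  by rewrite /=; field.
rewrite evZ -[2^-1 in X in bnd _ X]ger0_norm//; apply: (bndZR pP).
rewrite evM; apply: bndM => //.
  by rewrite sqtS divr_ge0// sqr_ge0.
by rewrite evD; apply: (bndD pP CS); exact: bnd_sqiter.
Qed.

Lemma sqrt_approx a W e : 0 < e -> bnd (ev a W) 1 -> exists Q : {poly R},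
  bnd (ev a (1 - Q)) 1 /\ bnd (ev a (Q ^+ 2 - (1 - W))) e.
Proof.
move=> e0 W1; have [n /(_ n (leqnn _)) ne] := sqt_cvg e0.
exists (1 - sqiter W n); split.
  by rewrite subKr; exact: (bnd_le (sqt_le1 n) (bnd_sqiter _ W1)).
rewrite sqiter_sqr addrAC subrr add0r evZ.
(* Twice the scalar increment is (1 - [sqt n])^2, at most 1 - [sqt n], hence below [e]. *)
apply: (@bnd_le _ _ _ _ _ (`|2| * (sqt n.+1 - sqt n))); last first.
  exact: (bndZR pP 2 (bnd_sqiterS n W1)).
rewrite ger0_norm// sqtS mulrCA divff// mulr1.
have /andP[s0 _] := sqt_bound n; have := sqt_ge0 n; nra.
Qed.

(** The operator u = f + i g is normal with u* u = f^2 + g^2, so the C*-identity bounds u, and f is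
    the mean of u and u*. *)
Lemma bnd_sum_sqr a f g d : astar a = a -> 0 <= d ->
  bnd (ev a (f ^+ 2 + g ^+ 2)) d -> bnd (ev a f) (Num.sqrt d).
Proof.
move=> sa d0 fg.
set c := ev a f; set s := ev a g; set u := c + 'i%C *: s.
have cs : c ** s = s ** c by exact: ev_comm.
have conji : ('i%C : R[i])^*%R = - 'i%C by rewrite complexiE conjCi.
have us : astar u = c - 'i%C *: s.
  by rewrite /u astarD astarZ conji scaleNr !ev_star.
have uu : astar u ** u = ev a (f ^+ 2 + g ^+ 2).
  rewrite us /u amulBl !amulDr !amulZl !amulZr cs evD !ev_sqr -/c -/s.
  rewrite scalerA -expr2 sqr_i scaleN1r opprD opprK addrACA -addrA.
  by rewrite addKr.
have ub : bnd u (Num.sqrt d).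
  by apply: (bnd_cstar pP CS); rewrite ?sqrtr_ge0// uu sqr_sqrtr.
have ub' := bnd_star pP CS (sqrtr_ge0 d) ub.
have -> : c = 2^-1 *~: (u + astar u).
  rewrite us /u addrACA subrr addr0 scalerDr -scalerDl -rmorphD/=.
  by rewrite (_ : 2^-1 + 2^-1 = 1) ?scale1r//; field.
have -> : Num.sqrt d = `|2^-1| * (Num.sqrt d + Num.sqrt d) by rewrite ger0_norm//; field.
by apply: (bndZR pP); exact: (bndD pP CS).
Qed.

Lemma bnd_sum_sqr2 a f g d : astar a = a -> 0 <= d ->
  bnd (ev a (f ^+ 2 + g ^+ 2)) d -> bnd (ev a (f ^+ 2)) d.
Proof.
move=> sa d0 /(bnd_sum_sqr sa d0) fd; rewrite ev_sqr -(sqr_sqrtr d0) expr2.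
by apply: bndM => //; exact: sqrtr_ge0.
Qed.

(** Since 1 - f^2 is nearly a square Q^2 and Q^2 + f^2 is nearly 1, the bound on one term of a sum
    of squares applies to Q^2. *)
Lemma bnd_1B_sqr a f : astar a = a -> bnd (ev a f) 1 -> bnd (ev a (1 - f ^+ 2)) 1.
Proof.
move=> sa f1; apply: bnd_closed => e e0.
have f2 : bnd (ev a (f ^+ 2)) 1 by rewrite ev_sqr -[1]mulr1; apply: bndM.
have [Q [_ Qe]] := sqrt_approx (divr_gt0 e0 (ltr0n _ 2)) f2.
set r := Q ^+ 2 - (1 - f ^+ 2) in Qe.
have -> : 1 - f ^+ 2 = Q ^+ 2 - r by rewrite /r; ring.
have -> : 1 + e = (1 + e / 2) + e / 2 by field.
rewrite evB; apply: (bndB pP CS) => //.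
apply: (bnd_sum_sqr2 (g := f) sa); first by lra.
have -> : Q ^+ 2 + f ^+ 2 = 1 + r by rewrite /r; ring.
by rewrite evD ev1; apply: (bndD pP CS) => //; exact: bnd_id.
Qed.

(** For self-adjoint [T] this places the spectrum in [0, 2 t]. Sums are stable by the triangle
    inequality alone; self-adjointness is required separately where needed. *)
Definition posop T := exists2 t, 0 <= t & bnd (t *~: idop E - T) t.

Lemma posop_gt0 T : posop T -> exists2 t, 0 < t & bnd (t *~: idop E - T) t.
Proof.
move=> [t t0 Tt]; exists (t + 1); first by lra.
rewrite rmorphD/= scalerDl addrAC; apply: (bndD pP CS) => //.
by rewrite scale1r; exact: bnd_id.
Qed.

Lemma posopD S T : posop S -> posop T -> posop (S + T).
Proof.
move=> [s s0 Ss] [t t0 Tt]; exists (s + t); first by lra.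
by rewrite rmorphD/= scalerDl opprD addrACA; exact: (bndD pP CS).
Qed.

Lemma posopZ r T : 0 <= r -> posop T -> posop (r *~: T).
Proof.
move=> r0 [t t0 Tt]; exists (r * t); first by rewrite mulr_ge0.
rewrite rmorphM/= -scalerA -scalerBr -[r in X in bnd _ X]ger0_norm//.
exact: (bndZR pP).
Qed.

Lemma posop_sub T d : 0 <= d -> bnd T d -> posop (d *~: idop E - T).
Proof. by move=> d0 Td; exists d => //; rewrite subKr. Qed.

Lemma posop_sqrt a f e : posop (ev a f) -> 0 < e ->
  exists Q, bnd (ev a (Q ^+ 2 - f)) e.
Proof.
move=> /posop_gt0[t t0 ft] e0.
pose W : {poly R} := 1 - t^-1 *: f.
have W1 : bnd (ev a W) 1.
  rewrite /W evB evZ ev1.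
  have -> : idop E - t^-1 *~: ev a f = t^-1 *~: (t *~: idop E - ev a f).
    by rewrite scalerBr scalerA -rmorphM mulVf ?gt_eqF// scale1r.
  have -> : 1 = `|t^-1| * t by rewrite gtr0_norm ?invr_gt0// mulVf ?gt_eqF.
  exact: (bndZR pP).
have [Q [_ Qe]] := sqrt_approx (divr_gt0 e0 t0) W1.
exists (Num.sqrt t *: Q).
have -> : (Num.sqrt t *: Q) ^+ 2 - f = t *: (Q ^+ 2 - (1 - W)).
  rewrite /W subKr scalerBr scalerA divff ?gt_eqF// scale1r.
  by rewrite exprZn sqr_sqrtr// ltW.
have -> : e = `|t| * (e / t) by rewrite gtr0_norm// mulrCA divff ?mulr1// gt_eqF.
by rewrite evZ; exact: (bndZR pP).
Qed.

(** Both [T] and d - [T] are nearly squares, and their sum is nearly d, so [bnd_sum_sqr2] bounds the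
    first. *)
Lemma posop_between T d : astar T = T -> 0 <= d ->
  posop T -> posop (d *~: idop E - T) -> bnd T d.
Proof.
move=> sT d0 pT pT'; apply: bnd_closed => e e0.
have e3 : 0 < e / 3 by rewrite divr_gt0.
rewrite -{1}[T]evX in pT; have [Q Qe] := posop_sqrt pT e3.
have pT2 : posop (ev T (d%:P - 'X)) by rewrite evB evC evX.
have [Q' Qe'] := posop_sqrt pT2 e3.
rewrite -[T]evX; set r := Q ^+ 2 - 'X in Qe; set r' := Q' ^+ 2 - _ in Qe'.
have -> : 'X = Q ^+ 2 - r by rewrite subKr.
have -> : d + e = (d + (e / 3 + e / 3)) + e / 3 by field.
rewrite evB; apply: (bndB pP CS) => //; apply: (bnd_sum_sqr2 (g := Q') sT); first by lra.
have -> : Q ^+ 2 + Q' ^+ 2 = d%:P + (r + r') by rewrite /r /r'; ring.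
rewrite evD evC (evD _ r); apply: (bndD pP CS); first exact: (bnd_idZ pP).
exact: (bndD pP CS Qe Qe').
Qed.

(** The witness t of positivity may be replaced by any bound of [T]. This is what makes the cone
    closed: the witnesses of approximants could otherwise be unbounded. *)
Lemma posop_bnd T d : astar T = T -> 0 <= d -> posop T -> bnd T d ->
  bnd (d *~: idop E - T) d.
Proof.
move=> sT d0 pT Td; apply: posop_between => //.
- by rewrite astarB astarZR astar_idop sT.
- exact: posop_sub.
- by rewrite subKr.
Qed.

Lemma posop_closed T d : 0 <= d -> bnd T d ->
  (forall e, 0 < e -> exists T', [/\ astar T' = T', posop T' & bnd (T - T') e]) ->
  posop T.
Proof.
move=> d0 Td TT; exists d => //; apply: bnd_closed => e e0.
have e3 : 0 < e / 3 by rewrite divr_gt0.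
have [T' [sT pT Te]] := TT _ e3.
have T'd : bnd T' (d + e / 3).
  by rewrite -(subKr T T'); apply: (bndB pP CS).
have := posop_bnd sT _ pT T'd; rewrite addr_ge0 ?(ltW e3)// => /(_ isT) Td'.
have -> : d *~: idop E - T =
    ((d + e / 3) *~: idop E - T') - (T - T') - (e / 3) *~: idop E.
  rewrite rmorphD/= scalerDl opprB addrA subrK.
  by rewrite -[in RHS]addrA -opprD [T + _]addrC opprD addrA addrK.
have -> : d + e = (d + e / 3) + e / 3 + e / 3 by field.
apply: (bndB pP CS); last exact: (bnd_idZ pP (ltW e3)).
exact: (bndB pP CS).
Qed.

Lemma posop_sqr T k : astar T = T -> 0 <= k -> bnd T k -> posop (T ** T).
Proof.
move=> sT k0 Tk; pose l := k + 1; have l0 : 0 < l by rewrite /l; lra.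
have Tl : bnd T l by apply: bnd_le Tk; rewrite /l; lra.
exists (l ^+ 2); first exact: sqr_ge0.
have T1 : bnd (ev T (l^-1 *: 'X)) 1.
  rewrite evZ evX (_ : 1 = `|l^-1| * l); first exact: (bndZR pP).
  by rewrite gtr0_norm ?invr_gt0// mulVf ?gt_eqF.
have -> : (l ^+ 2) *~: idop E - T ** T = (l ^+ 2) *~: ev T (1 - (l^-1 *: 'X) ^+ 2).
  rewrite evB ev1 exprZn evZ ev_sqr evX scalerBr scalerA -rmorphM -exprMn.
  by rewrite divff ?gt_eqF// expr1n scale1r.
rewrite -[X in bnd _ X]mulr1 -[l ^+ 2 in X in bnd _ X]ger0_norm ?sqr_ge0//.
by apply: (bndZR pP); exact: bnd_1B_sqr.
Qed.

End SquareRoot.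

Arguments posop {R A E} p T.

(** * Positivity of b* b *)

Section CstarPositivity.
Context {R : realType} {A : locallyCstarType R} {E : hilbertModType A}.
Context {p : A -> R} (pP : cstar_seminorm [set: A] p) (CS : cauchy_schwarz E p).
Implicit Types (S T a b v : operator E) (d e k r t : R).

Local Notation bnd := (@bnd R A E p).
Local Notation posop := (@posop R A E p).

Lemma scale2 (V : lmodType R[i]) (x : V) : 2 *~: x = x + x.
Proof. by rewrite rmorphD/= scalerDl scale1r. Qed.

(** Writing v = h + i k with self-adjoint h and k, both sides are 4 h^2 + 4 k^2; hence v v* + v* v
    is positive without knowing it for either product. *)
Lemma sum_products_sqr v : 2 *~: (v ** astar v + astar v ** v) =
  (v + astar v) ** (v + astar v) +
  ('i%C *: (v - astar v)) ** ('i%C *: (v - astar v)).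
Proof.
rewrite amulZl amulZr scalerA -expr2 sqr_i scaleN1r scale2.
by rewrite !amulDl !amulDr !amulNl !amulNr; abelian.
Qed.

Lemma posop_sum_products v k : 0 <= k -> bnd v k ->
  posop (2 *~: (v ** astar v + astar v ** v)).
Proof.
move=> k0 vk; have vk' := bnd_star pP CS k0 vk.
rewrite sum_products_sqr; apply: (posopD pP CS).
  apply: (posop_sqr pP CS (k := k + k)); last exact: (bndD pP CS).
    by rewrite astarD astarK addrC.
  by rewrite addr_ge0.
apply: (posop_sqr pP CS (k := Normc.normc ('i%C : R[i]) * (k + k))).
- by rewrite astarZ complexiE conjCi scaleNr -scalerN astarB astarK opprB.
- by rewrite mulr_ge0 ?addr_ge0//= sqrtr_ge0.
- by apply: (bndZ pP); exact: (bndB pP CS).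
Qed.

(* Kaplansky's argument. With a = b* b, y = |a| - a (twice the negative part of
   a) and z = b y one has, up to small errors, z* z = y a y <= 0; then
   z z* + z* z >= 0 gives z z* >= 0, and applying the same to z sqrt|a| y shows
   (z z* )^2 <= 0. Hence z, and therefore y, is small. *)
Lemma bnd_1B_cstar b : bnd b 1 -> bnd (idop E - astar b ** b) 1.
Proof.
move=> b1; set a := astar b ** b.
have sa : astar a = a by rewrite astarM astarK.
have b1' := bnd_star pP CS ler01 b1.
have a1 : bnd a 1 by rewrite -[1]mulr1; exact: bndM.
apply: bnd_closed => dl dl0.
(* The argument ends with a bound 7 [eta] for Y^4, and two square roots turn it into [dl] for Y. The
   540 in [e] makes the bound 540 e on half of [err] equal to eta^2. *)
pose eta := Num.min 1 (dl ^+ 4 / 7).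
have eta0 : 0 < eta by rewrite lt_min ltr01 divr_gt0// exprn_gt0.
have eta1 : eta <= 1 by rewrite ge_min lexx.
have etad : 7 * eta <= dl ^+ 4 by rewrite mulrC -ler_pdivlMr// ge_min lexx orbT.
pose e := eta ^+ 2 / 540.
have eta2 : 0 < eta ^+ 2 by rewrite exprn_gt0.
have e0 : 0 < e by rewrite /e; lra.
have e1 : e <= eta / 540.
  have : eta ^+ 2 <= eta by rewrite expr2 ger_pMl.
  by rewrite /e; lra.
have ee : eta ^+ 2 = 540 * e by rewrite /e; field.
clearbody e eta.
have W1 : bnd (ev a (1 - 'X ^+ 2)) 1 by apply: (bnd_1B_sqr pP CS) => //; rewrite evX.
have [Q [Q1 Qe]] := sqrt_approx pP CS e0 W1; rewrite subKr in Qe.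
have Q2 : bnd (ev a Q) 2.
  rewrite -[Q](subKr 1) evB ev1; apply: (bndB pP CS) => //; exact: bnd_id.
have pQ : posop (ev a Q) by exists 1 => //; rewrite scale1r -(ev1 a) -evB.
have [P Pe] := posop_sqrt pP CS pQ e0.
have P2 : bnd (ev a P) 2.
  apply: (bnd_sa pP CS); rewrite ?ev_star// -ev_sqr.
  rewrite -[P ^+ 2](subrK Q) evD; apply: (@bnd_le _ _ _ _ _ (e + 2)); last exact: (bndD pP CS).
  by lra.
(* Here [Q] stands for |a| and [P] for its square root, with errors [Rm] and [Sm]. The sigma types
   keep these polynomials opaque. *)
have [Rm RmE] : {r : {poly R} | r = Q ^+ 2 - 'X ^+ 2} by exists (Q ^+ 2 - 'X ^+ 2).
have [Sm SmE] : {s : {poly R} | s = P ^+ 2 - Q} by exists (P ^+ 2 - Q).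
have [Y YE] : {y : {poly R} | y = Q - 'X} by exists (Q - 'X).
rewrite -RmE in Qe; rewrite -SmE in Pe.
have Y3 : bnd (ev a Y) 3.
  by rewrite YE evB evX (_ : 3 = 2 + 1); [exact: (bndB pP CS)|ring].
have [T TE] : {t : {poly R} | t = Y * Rm + Y ^+ 2 * Sm} by exists (Y * Rm + Y ^+ 2 * Sm).
have T1 : bnd (ev a T) (12 * e).
  rewrite TE evD (evM _ Y) (evM _ (Y ^+ 2)) ev_sqr (_ : 12 * e = 3 * e + 3 * 3 * e); last by ring.
  by apply: (bndD pP CS); do !apply: bndM.
have PY6 : bnd (ev a (P * Y)) 6.
  by rewrite evM (_ : 6 = 2 * 3); [apply: bndM|ring].
have [z zE] : {z | z = b ** ev a Y} by exists (b ** ev a Y).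
have sev f : astar (ev a f) = ev a f by exact: ev_star.
(* For exact roots a Y = - |a| Y, so Y a Y would be - (P Y)^2; [T] collects the error. *)
have zz : astar z ** z = ev a (T - (P * Y) ^+ 2).
  rewrite zE astarM sev -!amulA (amulA (astar b)) -/a -[in X in _ ** (X ** _)](evX a).
  by rewrite -!evM TE RmE SmE YE; congr ev; ring.
have [v vE] : {v | v = z ** ev a (P * Y)} by exists (z ** ev a (P * Y)).
have vv : astar v ** v = ev a (P * Y * T * (P * Y)) - ev a (((P * Y) ^+ 2) ^+ 2).
  rewrite vE astarM sev -!amulA (amulA (astar z)) zz -!evM -evB.
  by congr ev; ring.
have z3 : bnd z 3 by rewrite zE -[3]mul1r; exact: bndM.
have z3' := bnd_star pP CS (ler0n _ 3) z3.
have v18 : bnd v 18 by rewrite vE (_ : 18 = 3 * 6); [apply: bndM|ring].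
have [w wE] : {w | w = z ** astar z} by exists (z ** astar z).
have sw : astar w = w by rewrite wE astarM astarK.
have w9 : bnd w 9 by rewrite wE (_ : 9 = 3 * 3); [apply: bndM|ring].
(* Both w^2 + v v* and v* v + (P Y)^4 are pure error terms. Their sum exhibits w^2 as an error minus
   positive operators. *)
have ww : w ** w = z ** ev a T ** astar z - v ** astar v.
  rewrite wE -amulA (amulA (astar z)) zz evB amulBl amulBr ev_sqr.
  by rewrite vE astarM sev !amulA.
pose err := 2 *~: (z ** ev a T ** astar z + ev a (P * Y * T * (P * Y))).
have sume : 2 *~: (w ** w) + (2 *~: (v ** astar v + astar v ** v) +
    2 *~: ev a (((P * Y) ^+ 2) ^+ 2)) = err.
  by rewrite /err ww vv -!scalerDr; congr (_ *: _); abelian.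
have erre : bnd err (2 * (eta ^+ 2)).
  rewrite /err -[2 in X in bnd _ X]ger0_norm//; apply: (bndZR pP).
  have -> : eta ^+ 2 = 3 * (12 * e) * 3 + 6 * (12 * e) * 6 by rewrite ee; ring.
  by apply: (bndD pP CS); rewrite ?evM; do !apply: bndM => //; rewrite -?evM// ?mulr_ge0 ?ltW.
have w2 : bnd (2 *~: (w ** w)) (2 * eta ^+ 2).
  apply: (posop_between pP CS).
  - by rewrite astarZR astarM sw.
  - by rewrite mulr_ge0// sqr_ge0.
  - by apply: posopZ => //; exact: (posop_sqr pP CS sw _ w9).
  - have -> : (2 * eta ^+ 2) *~: idop E - 2 *~: (w ** w) =
      ((2 * eta ^+ 2) *~: idop E - err) + (2 *~: (v ** astar v + astar v ** v) +
        2 *~: ev a (((P * Y) ^+ 2) ^+ 2)).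
      by rewrite -sume; abelian.
    apply: (posopD pP CS); first by apply: posop_sub => //; rewrite mulr_ge0// sqr_ge0.
    apply: (posopD pP CS); first exact: (posop_sum_products _ v18).
    apply: posopZ => //; rewrite ev_sqr; apply: (posop_sqr pP CS (k := 6 * 6)) => //.
    by rewrite ev_sqr; apply: bndM.
have weta : bnd w eta.
  apply: (bnd_sa pP CS (ltW eta0) sw).
  have -> : w ** w = 2^-1 *~: (2 *~: (w ** w)).
    by rewrite scalerA -rmorphM/= mulVf ?pnatr_eq0// scale1r.
  have -> : eta ^+ 2 = `|2^-1| * (2 * eta ^+ 2) by rewrite ger0_norm//; field.
  exact: (bndZR pP).
have zeta : bnd (astar z) (Num.sqrt eta).
  by apply: (bnd_cstar pP CS); rewrite ?sqrtr_ge0// astarK sqr_sqrtr ?(ltW eta0)// -wE.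
have zzeta : bnd (astar z ** z) eta.
  rewrite -(sqr_sqrtr (ltW eta0)) expr2.
  apply: bndM; [exact: sqrtr_ge0|exact: zeta|].
  by have := bnd_star pP CS (sqrtr_ge0 eta) zeta; rewrite astarK.
have PY2 : bnd (ev a ((P * Y) ^+ 2)) (12 * e + eta).
  have -> : (P * Y) ^+ 2 = T - (T - (P * Y) ^+ 2) by rewrite subKr.
  by rewrite evB -zz; exact: (bndB pP CS).
(* For exact roots Y^2 = 2 |a| Y, hence Y^4 = 2 Y (P Y)^2. The errors add up to 6 [eta] + 135 [e],
   below 7 [eta] because e <= eta / 540. *)
have Y4 : bnd (ev a (Y ^+ 4)) (7 * eta).
  have -> : Y ^+ 4 = Y * (((P * Y) ^+ 2 + (P * Y) ^+ 2) - (Y ^+ 2 * Sm + Y ^+ 2 * Sm + Y * Rm)).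
    by rewrite SmE RmE YE; ring.
  apply: (@bnd_le _ _ _ _ _ (3 * (((12 * e + eta) + (12 * e + eta)) +
    (3 * 3 * e + 3 * 3 * e + 3 * e)))); first by lra.
  rewrite evM; apply: bndM => //; rewrite evB; apply: (bndB pP CS).
    by rewrite evD; exact: (bndD pP CS).
  by rewrite !evD (evM _ Y) (evM _ (Y ^+ 2)) ev_sqr; do !apply: (bndD pP CS); do !apply: bndM.
have Ydl : bnd (ev a Y) dl.
  apply: (bnd_sa pP CS (ltW dl0)) => //; rewrite -ev_sqr.
  apply: (bnd_sa pP CS); rewrite ?sev ?sqr_ge0// -ev_sqr -!exprM.
  exact: bnd_le Y4.
have -> : idop E - a = ev a (1 - Q) + ev a Y.
  by rewrite -evD YE addrA subrK evB ev1 evX.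
exact: (bndD pP CS).
Qed.

Lemma posop_cstar b k : 0 <= k -> bnd b k -> posop (astar b ** b).
Proof.
move=> k0 bk; pose l := k + 1; have l0 : 0 < l by rewrite /l; lra.
have b1 : bnd (l^-1 *~: b) 1.
  apply: (@bnd_le _ _ _ _ _ (`|l^-1| * k)); last exact: (bndZR pP).
  by rewrite gtr0_norm ?invr_gt0// mulrC ler_pdivrMr// mul1r /l; lra.
have -> : astar b ** b = (l ^+ 2) *~: (astar (l^-1 *~: b) ** (l^-1 *~: b)).
  rewrite astarZR amulZl amulZr !scalerA -!rmorphM/= -expr2 -exprMn_comm; last exact: mulrC.
  by rewrite divff ?gt_eqF// expr1n scale1r.
apply: posopZ; rewrite ?sqr_ge0//; exists 1 => //.
by rewrite scale1r; exact: bnd_1B_cstar.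
Qed.

End CstarPositivity.

(** * Positive elements of A with respect to one seminorm *)

Section PositiveElements.
Context {R : realType} {A : locallyCstarType R}.
Context {p : A -> R} (pP : cstar_seminorm [set: A] p).
Implicit Types (a b c : A) (d e r s t : R).

Lemma selfmod_innerE (x y : selfmod A) : inner x y = astar x ** y :> A.
Proof. by []. Qed.

Lemma selfmod_cauchy_schwarz : cauchy_schwarz (selfmod A) p.
Proof.
by move=> x y; rewrite !selfmod_seminormE// (le_trans (cstarM pP _ _))// (cstar_astar pP).
Qed.

Let CS := selfmod_cauchy_schwarz.

Fact lmul_adjointable a : adjointable (fun x : selfmod A => a ** x : selfmod A).
Proof.
split=> [x y|c x|x b|].
- exact: amulDr.
- exact: amulZr.
- exact: amulA.
- by exists (fun x => astar a ** x) => x y; rewrite !selfmod_innerE astarM amulA.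
Qed.

Definition lmul a : operator (selfmod A) := mk_operator (lmul_adjointable a).

Lemma lmulE a (x : selfmod A) : op (lmul a) x = a ** x. Proof. by []. Qed.

Lemma astar_lmul a : astar (lmul a) = lmul (astar a).
Proof.
by apply: adjoint_uniq => x y; rewrite !selfmod_innerE !lmulE astarM amulA.
Qed.

Lemma lmulM a b : lmul (a ** b) = lmul a ** lmul b.
Proof. by apply: operator_eq => x; rewrite opmul !lmulE amulA. Qed.

Lemma lmulD a b : lmul (a + b) = lmul a + lmul b.
Proof. by apply: operator_eq => x; rewrite opadd !lmulE amulDl. Qed.

Lemma lmulB a b : lmul (a - b) = lmul a - lmul b.
Proof. by apply: operator_eq => x; rewrite opadd opopp !lmulE amulBl. Qed.

Lemma lmulZ (c : R[i]) a : lmul (c *: a) = c *: lmul a.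
Proof. by apply: operator_eq => x; rewrite opscale !lmulE amulZl. Qed.

Lemma bnd_lmul a : bnd p (lmul a) (p a).
Proof. by move=> x; rewrite !selfmod_seminormE//; exact: (cstarM pP). Qed.

Definition pos a := astar a = a /\ posop p (lmul a).

Lemma pos_cstar c : pos (astar c ** c).
Proof.
split; first by rewrite astarM astarK.
rewrite lmulM -astar_lmul; apply: (posop_cstar pP CS (cstar_ge0 pP c)).
exact: bnd_lmul.
Qed.

Lemma posD a b : pos a -> pos b -> pos (a + b).
Proof.
move=> [sa pa] [sb pb]; split; first by rewrite astarD sa sb.
by rewrite lmulD; exact: (posopD pP CS).
Qed.

Lemma posZ r a : 0 <= r -> pos a -> pos (r *~: a).
Proof.
move=> r0 [sa pa]; split; first by rewrite astarZR sa.
by rewrite lmulZ; exact: (posopZ pP).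
Qed.

Lemma pos_closed a : astar a = a ->
  (forall e, 0 < e -> exists2 a', pos a' & p (a - a') <= e) -> pos a.
Proof.
move=> sa H; split=> //; apply: (posop_closed pP CS (cstar_ge0 pP a) (bnd_lmul a)).
move=> e /H[a' [sa' pa'] ae]; exists (lmul a'); split=> //.
  by rewrite astar_lmul sa'.
by rewrite -lmulB; exact: (bnd_le ae (bnd_lmul _)).
Qed.

(** The sum of p(b) - b and b - a is p(b) - a, so left multiplication by [a] lies between 0 and
    p(b). Evaluating it at [a] itself and using the C*-identity returns a bound on p(a). *)
Lemma pos_mono a b : pos a -> pos (b - a) -> p a <= p b.
Proof.
move=> [sa pa] [sba pba].
have ab : bnd p (lmul a) (p b).
  apply: (posop_between pP CS) => //; rewrite ?astar_lmul ?sa ?(cstar_ge0 pP)//.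
  have -> : p b *~: idop _ - lmul a = (p b *~: idop _ - lmul b) + lmul (b - a).
    by rewrite lmulB; abelian.
  apply: (posopD pP CS) => //; apply: posop_sub; first exact: (cstar_ge0 pP).
  exact: bnd_lmul.
have [->|pa0] := eqVneq (p a) 0; first exact: (cstar_ge0 pP).
have pa1 : 0 < p a by rewrite lt_neqAle eq_sym pa0 (cstar_ge0 pP).
rewrite -(ler_pM2r pa1) -expr2 -(cstar_sqr pP) sa.
by have := ab a; rewrite !selfmod_seminormE.
Qed.

(** With r^2 close to [T], the element is close to (r b)* (r b), and positive elements are
    closed. *)
Lemma pos_form (T : operator (selfmod A)) b : astar T = T -> posop p T ->
  pos (astar b ** op T b).
Proof.
move=> sT pT; apply: pos_closed.
  have := inner_star (b : selfmod A) (op T b).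
  by rewrite inner_opl sT !selfmod_innerE.
move=> e e0; pose e' := e / (p b ^+ 2 + 1).
have pb1 : 0 < p b ^+ 2 + 1 by have := sqr_ge0 (p b); lra.
have e'0 : 0 < e' by rewrite divr_gt0.
rewrite -[T]evX in pT; have [Q Qe] := posop_sqrt pP CS pT e'0.
pose r := ev T Q; exists (astar (op r b : A) ** op r b); first exact: pos_cstar.
have -> : astar (op r b : A) ** op r b = astar b ** op (r ** r) b.
  rewrite -[LHS](selfmod_innerE (op r b) (op r b)) inner_opl ev_star//.
have -> : astar b ** op T b - astar b ** op (r ** r) b =
    - (astar b ** op (ev T (Q ^+ 2 - 'X)) b).
  by rewrite evB evX ev_sqr opadd opopp amulBr opprB.
rewrite (cstarN pP) (le_trans (cstarM pP _ _))// (cstar_astar pP).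
have := Qe b; rewrite !selfmod_seminormE// => Qb.
apply: (@le_trans _ _ (p b * (e' * p b))); first by rewrite ler_wpM2l ?(cstar_ge0 pP).
rewrite mulrCA -expr2 /e' mulrAC ler_pdivrMr// ler_wpM2l ?(ltW e0)//; lra.
Qed.

(** The operator s - [lmul a] on A is positive; its quadratic form at [b] lies in A although the
    unit need not. *)
Lemma pos_le_norm a b s : astar a = a -> p a <= s ->
  pos (s *~: (astar b ** b) - astar b ** (a ** b)).
Proof.
move=> sa as_; have s0 : 0 <= s by rewrite (le_trans _ as_)// (cstar_ge0 pP).
have -> : s *~: (astar b ** b) - astar b ** (a ** b) =
    astar b ** op (s *~: idop (selfmod A) - lmul a) b.
  by rewrite opadd opopp opscale opid lmulE amulBr amulZr.
apply: pos_form; first by rewrite astarB astarZR astar_idop astar_lmul sa.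
by apply: posop_sub => //; exact: (bnd_le as_ (bnd_lmul a)).
Qed.

Lemma pos0 : pos 0.
Proof. by rewrite -(amulr0 (astar 0)); exact: pos_cstar. Qed.

Lemma pos_positive a : Defs.positive setT a -> pos a.
Proof. by move=> [b _ ->]; exact: pos_cstar. Qed.

End PositiveElements.

Arguments pos {R A} p a.

(** * Cauchy-Schwarz and order estimates for quadratic forms *)

Section PositiveForms.
Context {R : realType} {A : locallyCstarType R} {E : hilbertModType A}.
Context {p : A -> R} (pP : cstar_seminorm [set: A] p).
Implicit Types (x y : E) (T : operator E) (c s : R).

Lemma pos_inner x : pos p (inner x x).
Proof. exact: (pos_positive pP (inner_ge0 x)). Qed.

(** With a = <x, T y>, expand the form at x a - s y and replace a* <x, T x> a by the larger s a* a;
    dividing by s leaves the claim. *)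
Lemma pos_form_cauchy_schwarz T x y s : astar T = T ->
  (forall z, pos p (inner z (op T z))) -> 0 < s -> p (inner x (op T x)) <= s ->
  pos p (s *~: inner y (op T y) - astar (inner x (op T y)) ** inner x (op T y)).
Proof.
move=> sT pT s0 xs; set a := inner x (op T y).
have aE : astar a = inner y (op T x) by rewrite /a inner_star inner_opl sT.
have sx : astar (inner x (op T x)) = inner x (op T x) by rewrite inner_star inner_opl sT.
have := posZ pP (ltW (divr_gt0 ltr01 s0)) (posD pP
  (pT (ract x a - s *~: y)) (pos_le_norm pP a sx xs)).
suff -> : (1 / s) *~: (inner (ract x a - s *~: y) (op T (ract x a - s *~: y)) +
    (s *~: (astar a ** a) - astar a ** (inner x (op T x) ** a))) =
  s *~: inner y (op T y) - astar a ** a by [].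
rewrite opB opZ op_ract !innerBl !innerBr !innerMl !innerMr !innerZr !innerZRl -aE -/a amulZr amulZl.
rewrite scalerA -rmorphM/=.
set u := astar a ** a; set v := inner y (op T y).
have -> : astar a ** (inner x (op T x) ** a) - s *~: u - (s *~: u - (s * s) *~: v) +
   (s *~: u - astar a ** (inner x (op T x) ** a)) = (s * s) *~: v - s *~: u by abelian.
by rewrite scalerBr !scalerA -!rmorphM/= mul1r mulrA mulVf ?gt_eqF// mul1r scale1r.
Qed.

Lemma pos_form_cauchy_schwarz_norm T x y : astar T = T ->
  (forall z, pos p (inner z (op T z))) ->
  p (inner x (op T y)) ^+ 2 <= p (inner x (op T x)) * p (inner y (op T y)).
Proof.
move=> sT pT; have q0 := cstar_ge0 pP (inner y (op T y)).
apply/ler_addgt0Pr => e e0.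
set s := p (inner x (op T x)) + e / (p (inner y (op T y)) + 1).
have q1 : 0 < p (inner y (op T y)) + 1 by lra.
have eq0 : 0 < e / (p (inner y (op T y)) + 1) by rewrite divr_gt0.
have s0 : 0 < s by rewrite /s; have := cstar_ge0 pP (inner x (op T x)); lra.
have xs : p (inner x (op T x)) <= s by rewrite /s; lra.
have := pos_mono pP (pos_cstar pP _) (pos_form_cauchy_schwarz y sT pT s0 xs).
rewrite (cstar_sqr pP) (cstarZR pP) gtr0_norm// => /le_trans; apply.
rewrite /s mulrDl lerD2l mulrAC ler_pdivrMr// ler_wpM2l ?(ltW e0)//; lra.
Qed.

Lemma hilbert_cauchy_schwarz : cauchy_schwarz E p.
Proof.
move=> x y; rewrite -(ler_pXn2r (n := 2))// ?nnegrE ?mulr_ge0 ?seminormE_ge0 ?(cstar_ge0 pP)//.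
rewrite exprMn !(seminormE_sqr pP).
have := @pos_form_cauchy_schwarz_norm (idop E) x y (astar_idop) _; apply=> z.
exact: pos_inner.
Qed.

(** Cauchy-Schwarz for the form of [T], at the pair T x and x, bounds the square of p(<T x, T x>) by
    c p(<T x, T x>) times c p(<x, x>). *)
Lemma bnd_of_form T c : astar T = T -> 0 <= c ->
  (forall x, pos p (inner x (op T x))) ->
  (forall x, pos p (c *~: inner x x - inner x (op T x))) -> bnd p T c.
Proof.
move=> sT c0 pT pcT x.
have le z : p (inner z (op T z)) <= c * p (inner z z).
  by have := pos_mono pP (pT z) (pcT z); rewrite (cstarZR pP) ger0_norm.
apply: (seminormE_le pP); first by rewrite mulr_ge0 ?seminormE_ge0.
rewrite exprMn (seminormE_sqr pP); set u := op T x.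
have := pos_form_cauchy_schwarz_norm u x sT pT; rewrite -/u => h.
have [->|u0] := eqVneq (p (inner u u)) 0; first by rewrite mulr_ge0 ?sqr_ge0 ?(cstar_ge0 pP).
have u1 : 0 < p (inner u u) by rewrite lt_neqAle eq_sym u0 (cstar_ge0 pP).
rewrite -(ler_pM2r u1) -expr2 (le_trans h)// mulrC.
have -> : c ^+ 2 * p (inner x x) * p (inner u u) = (c * p (inner x x)) * (c * p (inner u u)) by ring.
by rewrite ler_pM ?(cstar_ge0 pP) ?le.
Qed.

End PositiveForms.

(** * Topology of Hilbert modules *)

Section Translation.
Context {V : TopologicalNmodule.type}.

Lemma nbhs_add (x y : V) U : nbhs (x + y) U ->
  exists X Y, [/\ nbhs x X, nbhs y Y & forall a b, X a -> Y b -> U (a + b)].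
Proof.
move=> /(@add_continuous V (x, y)) [[/= X Y] [xX yY] XY].
by exists X, Y; split=> // a b Xa Yb; exact: (XY (a, b)).
Qed.

End Translation.

Section SeminormFamily.
Context {R : realType} {A : locallyCstarType R}.
Implicit Types p q : A -> R.

Lemma cstar_seminorms0 : cstar_seminorms A (fun=> 0).
Proof.
split; last exact/continuous_subspace_setT/cst_continuous.
by split=> *; rewrite ?addr0 ?mulr0 ?expr0n.
Qed.

Lemma cstar_seminormsU p q : cstar_seminorms A p -> cstar_seminorms A q ->
  cstar_seminorms A (p \max q).
Proof.
move=> [pP pc] [qP qc]; split; last first.
  by move=> x; apply: continuous_max; [exact: pc|exact: qc].
split=> [a b _ _|c a _|a b _ _|a _] /=.
- rewrite ge_max; apply/andP; split.
    by rewrite (le_trans (cstarD pP _ _))// lerD// le_max lexx.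
  by rewrite (le_trans (cstarD qP _ _))// lerD// le_max lexx orbT.
- rewrite (cstarZ pP) (cstarZ qP) maxr_pMr//.
  by case: c => x y /=; exact: sqrtr_ge0.
- rewrite ge_max; apply/andP; split.
    by rewrite (le_trans (cstarM pP _ _))// ler_pM ?(cstar_ge0 pP)// le_max lexx.
  by rewrite (le_trans (cstarM qP _ _))// ler_pM ?(cstar_ge0 qP)// le_max lexx orbT.
- rewrite (cstar_sqr pP) (cstar_sqr qP).
  have [pq|qp] := leP (p a) (q a).
    by rewrite max_r// ler_pXn2r ?nnegrE ?(cstar_ge0 pP) ?(cstar_ge0 qP).
  by rewrite max_l// ler_pXn2r ?nnegrE ?(cstar_ge0 pP) ?(cstar_ge0 qP)// ltW.
Qed.

End SeminormFamily.

Section HilbertTopology.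
Context {R : realType} {A : locallyCstarType R} {E : hilbertModType A}.
Implicit Types (p q : A -> R) (x y z : E) (u : nat -> E) (e : R).

Lemma nbhs0_seminormE p e : cstar_seminorms A p -> 0 < e ->
  nbhs (0 : E) [set x | seminormE p x < e].
Proof.
move=> pA e0.
have /(hilbert_topology (nbhs (0 : E)) _) H : nbhs (0 : E) --> (0 : E) by [].
have /H : [set seminormE p | p in cstar_seminorms A] (seminormE p : E -> R) by exists p.
move=> /(@cvgr_lt R _ _ _ _ 0)/(_ e e0).
by [].
Qed.

(** The topology is axiomatized through convergent filters, so the axiom is applied to the filter
    generated by the seminorm balls, directed because a maximum of two C*-seminorms is one. *)
Lemma nbhs0_seminormE_ex (U : set E) : nbhs 0 U ->
  exists p e, [/\ cstar_seminorms A p, 0 < e & forall x, seminormE p x < e -> U x].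
Proof.
pose F : set_system E := [set U | exists p e,
  [/\ cstar_seminorms A p, 0 < e & forall x, seminormE p x < e -> U x]].
have FF : Filter F.
  split.
  - by exists (fun=> 0), 1; split=> //; exact: cstar_seminorms0.
  - move=> P Q [p [e [pA e0 pP]]] [q [d [qA d0 qQ]]].
    exists (p \max q), (Num.min e d); split; first exact: cstar_seminormsU.
      by rewrite lt_min e0.
    move=> x; rewrite lt_min => /andP[xe xd]; split.
      apply: pP; apply: le_lt_trans xe; rewrite ler_wsqrtr//.
      by rewrite le_max lexx.
    apply: qQ; apply: le_lt_trans xd; rewrite ler_wsqrtr//.
    by rewrite le_max lexx orbT.
  - by move=> P Q PQ [p [e [pA e0 pP]]]; exists p, e; split=> // x /pP/PQ.
suff : F --> (0 : E) by apply.
apply/(hilbert_topology F FF) => _ [p pA <-].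
apply/cvgr0Pnorm_lt => e e0; exists p, e; split=> // x.
by rewrite /= ger0_norm ?seminormE_ge0.
Qed.

Lemma closed_seminormE (M : set E) z : closed M ->
  (forall p e, cstar_seminorms A p -> 0 < e -> exists2 m, M m & seminormE p (m - z) < e) ->
  M z.
Proof.
move=> cM H; apply: cM => U; rewrite -{1}[z]addr0 => /nbhs_add[X [Y [zX Y0 XY]]].
have [p [e [pA e0 pY]]] := nbhs0_seminormE_ex Y0.
have [m Mm me] := H p e pA e0; exists m; split=> //.
by rewrite -(subrKC z m); apply: XY (nbhs_singleton zX) (pY _ _).
Qed.

Lemma closure_seminormE (M : set E) z p e : closure M z -> cstar_seminorms A p -> 0 < e ->
  exists2 m, M m & seminormE p (m - z) < e.
Proof.
move=> cM pA e0; have := nbhs0_seminormE pA e0.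
rewrite -{1}(subrr z) => /nbhs_add[X [Y [zX zY XY]]].
have [m [Mm Xm]] := cM _ zX; exists m => //.
exact: XY Xm (nbhs_singleton zY).
Qed.

Lemma hilbert_sep x : (forall p, cstar_seminorms A p -> seminormE p x = 0) -> x = 0.
Proof.
move=> x0; apply/(inner_eq0 (A := A)); apply: locally_cstar_sep => p pA.
have pP := pA.1; by rewrite -(seminormE_sqr pP) x0// expr0n.
Qed.

Lemma hilbert_complete_seq u :
  (forall p e, cstar_seminorms A p -> 0 < e -> exists N, forall n m, (N <= n)%N ->
     (n <= m)%N -> seminormE p (u m - u n) < e) ->
  exists x, forall p e, cstar_seminorms A p -> 0 < e -> exists N, forall n, (N <= n)%N ->
     seminormE p (u n - x) < e.
Proof.
move=> uC.
have [x ux] : exists x, u @ \oo --> x.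
  apply: hilbert_complete.
  apply/(hilbert_topology _ _) => _ [p pA <-].
  have pP := pA.1; have CS : cauchy_schwarz E p := hilbert_cauchy_schwarz pP.
  apply/cvgr0Pnorm_lt => e e0.
  have [N uN] := uC p e pA e0.
  exists ([set x | exists2 n, (N <= n)%N & x = u n], [set x | exists2 n, (N <= n)%N & x = u n]).
    by split=> /=; exists N => // n /= Nn; exists n.
  move=> [_ _] /= [[n Nn ->] [m Nm ->]]; rewrite ger0_norm ?seminormE_ge0//.
  have [mn|/ltnW nm] := leqP m n; first exact: uN.
  by rewrite -opprB (seminormEN pP); exact: uN.
exists x => p e pA e0.
have := nbhs0_seminormE pA e0; rewrite -{1}(subrr x) => /nbhs_add[X [Y [xX xY XY]]].
have [N _ uX] := ux _ xX; exists N => n Nn.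
exact: XY (uX _ Nn) (nbhs_singleton xY).
Qed.

Lemma seminormE_small_eq0 x :
  (forall p e, cstar_seminorms A p -> 0 < e -> seminormE p x <= e) -> x = 0.
Proof.
move=> xe; apply: hilbert_sep => p pA; apply/eqP; rewrite eq_le seminormE_ge0 andbT.
by apply/ler_addgt0Pr => e e0; rewrite add0r; exact: xe.
Qed.

Lemma selfadjoint_adjointable (T : E -> E) :
  (forall x y, inner (T x) y = inner x (T y) :> A) -> adjointable T.
Proof.
move=> TT; split=> [x y|c x|x a|].
- by apply: inner_injl => z; rewrite innerDr -!TT innerDr.
- by apply: inner_injl => z; rewrite innerZr -!TT innerZr.
- by apply: inner_injl => z; rewrite innerMr -!TT innerMr.
- by exists T.
Qed.

(** Pointwise limits exist by completeness of E. Self-adjointness survives them, and a self-adjoint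
    map is automatically linear, A-linear and adjointable. *)
Lemma operator_limit (S : nat -> operator E) :
  (forall n, astar (S n) = S n) ->
  (forall p e, cstar_seminorms A p -> 0 < e -> exists N, forall n m, (N <= n)%N ->
     (n <= m)%N -> bnd p (S m - S n) e) ->
  exists2 T : operator E, astar T = T & forall p e, cstar_seminorms A p -> 0 < e ->
    exists N, forall n, (N <= n)%N -> bnd p (S n - T) e.
Proof.
move=> sS SC.
have /choice[T TP] (x : E) : exists y : E, forall p e, cstar_seminorms A p -> 0 < e ->
    exists N, forall n, (N <= n)%N -> seminormE p (op (S n) x - y) < e.
  apply: hilbert_complete_seq => p e pA e0.
  have d0 : 0 < seminormE p x + 1 by have := seminormE_ge0 (p := p) x; lra.
  have [N SN] := SC p _ pA (divr_gt0 e0 d0); exists N => n m Nn nm.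
  apply: (le_lt_trans (SN _ _ Nn nm x)); rewrite mulrAC ltr_pdivrMr// ltr_pM2l//; lra.
have TT x y : inner (T x) y = inner x (T y) :> A.
  apply/subr0_eq; apply: locally_cstar_sep => p pA.
  have pP := pA.1; have CS : cauchy_schwarz E p := hilbert_cauchy_schwarz pP.
  apply/eqP; rewrite eq_le (cstar_ge0 pP) andbT; apply/ler_addgt0Pr => e e0; rewrite add0r.
  have x0 := seminormE_ge0 (p := p) x; have y0 := seminormE_ge0 (p := p) y.
  set d := seminormE p x + seminormE p y + 1.
  have d0 : 0 < d by rewrite /d; lra.
  have [N1 S1] := TP x p _ pA (divr_gt0 e0 d0).
  have [N2 S2] := TP y p _ pA (divr_gt0 e0 d0).
  set n := maxn N1 N2.
  have := S1 n (leq_maxl _ _); have := S2 n (leq_maxr _ _) => {}S2 {}S1.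
  have -> : inner (T x) y - inner x (T y) =
      inner x (op (S n) y - T y) - inner (op (S n) x - T x) y.
    by rewrite innerBr innerBl inner_opl sS; abelian.
  apply: (le_trans (cstarB pP _ _)).
  have h1 := CS x (op (S n) y - T y); have h2 := CS (op (S n) x - T x) y.
  have -> : e = seminormE p x * (e / d) + (e / d) * seminormE p y + e / d.
    by rewrite /d; field; rewrite -/d gt_eqF.
  have ed : 0 < e / d by rewrite divr_gt0.
  have : seminormE p x * seminormE p (op (S n) y - T y) <= seminormE p x * (e / d).
    by rewrite ler_wpM2l// ltW.
  have : seminormE p (op (S n) x - T x) * seminormE p y <= (e / d) * seminormE p y.
    by rewrite ler_wpM2r// ltW.
  by lra.
exists (mk_operator (selfadjoint_adjointable TT)).
  by apply: adjoint_uniq => x y; exact: TT.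
move=> p e pA e0; have pP := pA.1.
have CS : cauchy_schwarz E p := hilbert_cauchy_schwarz pP.
have [N SN] := SC p e pA e0; exists N => n Nn x.
rewrite opadd opopp /=; apply/ler_addgt0Pr => d d0.
have [M SM] := TP x p d pA d0.
have -> : op (S n) x - T x =
    (op (S (maxn n M)) x - T x) - op (S (maxn n M) - S n) x.
  by rewrite opadd opopp; abelian.
apply: (le_trans (seminormEB pP CS _ _)); rewrite addrC lerD//.
  by apply: SN => //; exact: leq_maxl.
by apply: ltW; apply: SM; exact: leq_maxr.
Qed.

End HilbertTopology.

(** * Resolvents of positive operators *)

Section Theta.
Context {R : realType} {A : locallyCstarType R} {E : hilbertModType A}.
Implicit Types (x y z : E) (T : operator E).

Lemma thetaE x y z : op (theta x y) z = ract x (inner y z). Proof. by []. Qed.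

Lemma astar_theta x y : astar (theta x y) = theta y x.
Proof.
by apply: adjoint_uniq => z t; rewrite !thetaE innerMl innerMr inner_star.
Qed.

Lemma amul_theta T x y : T ** theta x y = theta (op T x) y.
Proof. by apply: operator_eq => z; rewrite opmul !thetaE op_ract. Qed.

Lemma theta_amul T x y : theta x y ** T = theta x (op (astar T) y).
Proof. by apply: operator_eq => z; rewrite opmul !thetaE inner_opr. Qed.

Lemma bnd_theta p x y : cstar_seminorm setT p ->
  bnd p (theta x y) (seminormE p x * seminormE p y).
Proof.
move=> pP z; rewrite thetaE (le_trans (seminormE_ract pP _ _))// -mulrA ler_wpM2l ?seminormE_ge0//.
exact: hilbert_cauchy_schwarz.
Qed.

End Theta.

Section Resolvent.
Context {R : realType} {A : locallyCstarType R} {E : hilbertModType A}.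
Implicit Types (p : A -> R) (x y z : E) (H T D Q : operator E) (f : {poly R}) (c d e r : R).

Definition opositive T := astar T = T /\
  forall p, cstar_seminorms A p -> forall x, pos p (inner x (op T x)).

(** A hypothesis for now: that adjointable operators satisfy it is proved later by means of
    resolvents of bounded operators. *)
Definition obounded T := forall p, cstar_seminorms A p -> exists2 c, 0 <= c & bnd p T c.

Lemma opositiveD S T : opositive S -> opositive T -> opositive (S + T).
Proof.
move=> [sS pS] [sT pT]; split; first by rewrite astarD sS sT.
by move=> p pA x; rewrite opadd innerDr; apply: (posD pA.1); [exact: pS|exact: pT].
Qed.

Lemma opositiveZ r T : 0 <= r -> opositive T -> opositive (r *~: T).
Proof.
move=> r0 [sT pT]; split; first by rewrite astarZR sT.
by move=> p pA x; rewrite opscale innerZr; apply: (posZ pA.1) => //; exact: pT.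
Qed.

Lemma opositive0 : opositive 0.
Proof.
split; first exact: astar0.
by move=> p pA x; rewrite opzero inner0r; exact: (pos0 pA.1).
Qed.

Lemma opositive_theta x : opositive (theta x x).
Proof.
split=> [|p pA y]; first exact: astar_theta.
by rewrite thetaE innerMr -inner_star; exact: (pos_cstar pA.1).
Qed.

Lemma obounded_theta x y : obounded (theta x y).
Proof.
move=> p pA; exists (seminormE p x * seminormE p y); first by rewrite mulr_ge0 ?seminormE_ge0.
exact: (bnd_theta _ _ pA.1).
Qed.

Lemma oboundedD S T : obounded S -> obounded T -> obounded (S + T).
Proof.
move=> bS bT p pA; have [c c0 Sc] := bS p pA; have [d d0 Td] := bT p pA.
by exists (c + d); rewrite ?addr_ge0//; exact: (bndD pA.1 (hilbert_cauchy_schwarz pA.1)).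
Qed.

Lemma oboundedZ r T : obounded T -> obounded (r *~: T).
Proof.
move=> bT p pA; have [d d0 Td] := bT p pA.
by exists (`|r| * d); rewrite ?mulr_ge0//; exact: (bndZR pA.1).
Qed.

Lemma oboundedM S T : obounded S -> obounded T -> obounded (S ** T).
Proof.
move=> bS bT p pA; have [c c0 Sc] := bS p pA; have [d d0 Td] := bT p pA.
by exists (c * d); rewrite ?mulr_ge0//; exact: bndM.
Qed.

Lemma obounded_id : obounded (idop E).
Proof. by move=> p pA; exists 1 => //; exact: bnd_id. Qed.

Lemma obounded_ev T f : obounded T -> obounded (ev T f).
Proof.
move=> bT; elim/poly_ind: f => [|f c IH].
  by move=> p pA; exists 0 => //; rewrite ev0; exact: (bnd0 pA.1).
rewrite evD evMX evC; apply: oboundedD; first exact: oboundedM.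
by apply: oboundedZ; exact: obounded_id.
Qed.

Lemma posop_form p T x : cstar_seminorms A p -> astar T = T -> posop p T ->
  pos p (inner x (op T x)).
Proof.
move=> pA sT pT; have pP := pA.1; have CS : cauchy_schwarz E p := hilbert_cauchy_schwarz pP.
apply: (pos_closed pP); first by rewrite inner_star inner_opl sT.
move=> e e0; have d0 : 0 < seminormE p x ^+ 2 + 1 by have := sqr_ge0 (seminormE p x); lra.
have e'0 := divr_gt0 e0 d0.
rewrite -[T]evX in pT; have [Q Qe] := posop_sqrt pP CS pT e'0.
pose r := ev T Q; exists (inner (op r x) (op r x)); first exact: pos_inner.
have -> : inner x (op T x) - inner (op r x) (op r x) = - inner x (op (ev T (Q ^+ 2 - 'X)) x).
  rewrite inner_opl ev_star// evB evX ev_sqr opadd opopp opmul innerBr.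
  by rewrite opprB.
rewrite (cstarN pP) (le_trans (CS _ _))//; apply: (le_trans (ler_wpM2l (seminormE_ge0 _) (Qe x))).
rewrite mulrCA -expr2 mulrAC ler_pdivrMr// ler_wpM2l ?(ltW e0)//; lra.
Qed.

Lemma bnd_sub_form p H c d : cstar_seminorms A p -> opositive H -> 0 <= c -> bnd p H c -> c <= d ->
  bnd p (d *~: idop E - H) d.
Proof.
move=> pA [sH pH] c0 Hc cd; have d0 : 0 <= d by lra.
have sK : astar (d *~: idop E - H) = d *~: idop E - H by rewrite astarB astarZR astar_idop sH.
apply: (bnd_of_form pA.1 sK d0) => x.
  by apply: posop_form => //; apply: posop_sub => //; exact: bnd_le Hc.
rewrite opadd opopp opscale opid innerBr innerZr subKr; exact: pH.
Qed.

(* The factorial series 1/(1 + t) = \sum_k r_k(t) / (k + 2) with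
   r_k(t) = \prod_(1 <= j <= k) (j - t) / (j + 1) converges locally uniformly on
   t >= 0, whence for every positive operator, bounded or not. *)
Fixpoint respoly n : {poly R} :=
  if n is m.+1 then m.+2%:R^-1 *: ((m.+1%:R)%:P - 'X) * respoly m else 1.

Definition ressum n : {poly R} := \sum_(k < n) k.+2%:R^-1 *: respoly k.

Lemma ressumP n : (1 + 'X) * ressum n = 1 - respoly n.
Proof.
elim: n => [|n IH]; first by rewrite /ressum big_ord0 mulr0 subrr.
rewrite /ressum big_ord_recr/= -/(ressum n) mulrDr IH.
have n0 : (n.+2%:R : R) != 0 by rewrite pnatr_eq0.
have {1}-> : respoly n = n.+2%:R^-1 *: ((n.+2%:R)%:P * respoly n).
  by rewrite -mul_polyC mulrA -rmorphM mulVf// mul1r.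
have -> : (n.+2%:R)%:P = (n.+1%:R)%:P + 1 :> {poly R} by rewrite -polyC1 -polyCD natr1.
by rewrite -!mul_polyC; ring.
Qed.

(** Once n + 1 exceeds the bound of [H], the factor n + 1 - H is bounded by n + 1, so each step
    shrinks the bound by (n + 1) / (n + 2) and the product telescopes. *)
Lemma bnd_respoly p H : cstar_seminorms A p -> opositive H -> obounded H ->
  exists K d, 0 <= d /\ forall n, (K <= n)%N -> bnd p (ev H (respoly n)) (d / n.+1%:R).
Proof.
move=> pA pH bH; have [c c0 Hc] := bH p pA.
pose K := (Num.truncn c).+1.
have cK : c <= K%:R by rewrite ltW// truncnS_gt.
have [b b0 Hb] := obounded_ev (respoly K) bH pA.
exists K, (b * K.+1%:R); split; first by rewrite mulr_ge0.
move=> n /subnKC <-; elim: (n - K)%N => [|m IH].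
  by rewrite addn0 mulfK ?pnatr_eq0.
rewrite addnS /=; set N := (K + m)%N in IH *.
rewrite -scalerAl evZ evM evB evC evX.
have -> : b * K.+1%:R / N.+2%:R = `|N.+2%:R^-1| * (N.+1%:R * (b * K.+1%:R / N.+1%:R)).
  rewrite ger0_norm ?invr_ge0//.
  have u0 : N.+1%:R != 0 :> R by rewrite pnatr_eq0.
  have w0 : N.+2%:R != 0 :> R by rewrite pnatr_eq0.
  by move: (N.+1%:R) (N.+2%:R) (K.+1%:R) u0 w0 => u w k u0 w0; field; rewrite u0 w0.
apply: (bndZR pA.1); apply: bndM => //.
apply: (bnd_sub_form pA pH c0 Hc); rewrite (le_trans cK)// ler_nat.
by rewrite (leq_trans _ (leqnSn _))// leq_addr.
Qed.

(** The k-th term is at most d / ((k + 1) (k + 2)), a telescoping difference. *)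
Lemma bnd_ressum p H : cstar_seminorms A p -> opositive H -> obounded H ->
  exists K d, 0 <= d /\ forall n m, (K <= n)%N -> (n <= m)%N ->
    bnd p (ev H (ressum m) - ev H (ressum n)) (d / n.+1%:R).
Proof.
move=> pA pH bH; have [K [d [d0 Kd]]] := bnd_respoly pA pH bH.
exists K, d; split=> // n m Kn /subnKC <-.
suff : bnd p (ev H (ressum (n + (m - n))) - ev H (ressum n))
    (d / n.+1%:R - d / (n + (m - n)).+1%:R).
  by apply: bnd_le; rewrite gerBl divr_ge0.
elim: (m - n)%N => [|k IH]; first by rewrite addn0 !subrr; exact: (bnd0 pA.1).
rewrite addnS /ressum big_ord_recr/= -/(ressum _) evD addrAC.
set N := (n + k)%N in IH *.
have -> : d / n.+1%:R - d / N.+2%:R =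
    (d / n.+1%:R - d / N.+1%:R) + `|N.+2%:R^-1| * (d / N.+1%:R).
  rewrite ger0_norm ?invr_ge0// -[N.+2]addn1 natrD.
  have n1 : n.+1%:R != 0 :> R by rewrite pnatr_eq0.
  have n2 : N.+1%:R != 0 :> R by rewrite pnatr_eq0.
  have n3 : N.+1%:R + 1 != 0 :> R by rewrite natr1 pnatr_eq0.
  by move: (n.+1%:R) (N.+1%:R) n1 n2 n3 => u w u0 w0 w1; field; rewrite u0 w0 w1.
apply: (bndD pA.1 (hilbert_cauchy_schwarz pA.1)) => //.
rewrite evZ; apply: (bndZR pA.1); apply: Kd.
by rewrite (leq_trans Kn)// leq_addr.
Qed.

Lemma small_div d e : 0 <= d -> 0 < e -> exists N, forall n, (N <= n)%N -> d / n.+1%:R <= e.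
Proof.
move=> d0 e0; exists (Num.truncn (d / e)) => n Nn.
rewrite ler_pdivrMr ?ltr0n// mulrC -ler_pdivrMr//.
by rewrite (le_trans (ltW (truncnS_gt _)))// ler_nat ltnS.
Qed.

Definition resolvent_of H Q :=
  [/\ astar Q = Q, (idop E + H) ** Q = idop E & Q ** (idop E + H) = idop E].

Lemma resolvent_ex H : opositive H -> obounded H -> exists Q, resolvent_of H Q.
Proof.
move=> pH bH; have sH := pH.1.
have [|p e pA e0|Q sQ QP] := @operator_limit _ _ E (fun n => ev H (ressum n)).
- by move=> n; exact: ev_star.
- have [K [d [d0 Kd]]] := bnd_ressum pA pH bH.
  have [N Nd] := small_div d0 e0; exists (maxn K N) => n m.
  rewrite geq_max => /andP[Kn Nn] nm.
  exact: (bnd_le (Nd _ Nn) (Kd _ _ Kn nm)).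
exists Q.
have HQ : (idop E + H) ** Q = idop E.
  apply: operator_eq => x; apply/subr0_eq; apply: seminormE_small_eq0 => p e pA e0.
  have pP := pA.1; have CS : cauchy_schwarz E p := hilbert_cauchy_schwarz pP.
  have [c c0 Hc] := oboundedD obounded_id bH pA.
  have x0 := seminormE_ge0 (p := p) x.
  set b := (c + 1) * (seminormE p x + 1).
  have b0 : 0 < b by rewrite mulr_gt0//; lra.
  have eb := divr_gt0 e0 b0.
  have [N1 QN] := QP p _ pA eb.
  have [K [d [d0 Kd]]] := bnd_respoly pA pH bH.
  have [N2 Nd] := small_div d0 eb.
  pose n := maxn N1 (maxn K N2).
  have {}QN := QN n (leq_maxl _ _).
  have Kn : (K <= n)%N by rewrite (leq_trans _ (leq_maxr _ _))// leq_maxl.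
  have N2n : (N2 <= n)%N by rewrite (leq_trans _ (leq_maxr _ _))// leq_maxr.
  have rn := bnd_le (Nd _ N2n) (Kd _ Kn).
  have -> : op ((idop E + H) ** Q) x - op (idop E) x =
     op (- ((idop E + H) ** (ev H (ressum n) - Q)) - ev H (respoly n)) x.
    have -> : - ((idop E + H) ** (ev H (ressum n) - Q)) - ev H (respoly n) =
        (idop E + H) ** Q - idop E.
      have := congr1 (ev H) (ressumP n); rewrite evM evD evX ev1 evB ev1 => h.
      by rewrite amulBr h; abelian.
    by [].
  have : bnd p (- ((idop E + H) ** (ev H (ressum n) - Q)) - ev H (respoly n))
      (c * (e / b) + e / b).
    by apply: (bndB pP CS) => //; apply: (bndN pP); exact: bndM.
  move=> /(_ x)/le_trans; apply.
  have -> : (c * (e / b) + e / b) * seminormE p x =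
      e * (((c + 1) * seminormE p x) / b) by ring.
  rewrite ger_pMr// ler_pdivrMr// mul1r /b ler_wpM2l//; lra.
(* The left inverse is the adjoint of the right inverse. *)
split=> //; rewrite -[LHS]astarK astarM sQ astarD sH astar_idop HQ.
exact: astar_idop.
Qed.

Section ResolventTheory.
Context {H Q : operator E} (pH : opositive H) (HQ : resolvent_of H Q).

Let sQ : astar Q = Q. Proof. by case: HQ. Qed.

Lemma resolvent_apply x : x = op Q x + op H (op Q x).
Proof. by case: HQ => _ h _; rewrite -[in LHS](opid x) -h. Qed.

Lemma opositive_resolvent : opositive Q.
Proof.
split=> // p pA x; have pP := pA.1; set v := op Q x.
rewrite {1}[x]resolvent_apply -/v innerDl; apply: (posD pP); first exact: pos_inner.
by rewrite inner_opl pH.1; exact: pH.2.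
Qed.

Lemma opositive_1B_resolvent : opositive (idop E - Q).
Proof.
split=> [|p pA x]; first by rewrite astarB astar_idop sQ.
have pP := pA.1; rewrite opadd opopp opid; set v := op Q x.
have xv : x - v = op H v by rewrite {1}[x]resolvent_apply -/v; abelian.
rewrite xv {1}[x]resolvent_apply -/v innerDl; apply: (posD pP); first exact: pH.2.
exact: pos_inner.
Qed.

Lemma bnd_01 T p : opositive T -> opositive (idop E - T) -> cstar_seminorms A p -> bnd p T 1.
Proof.
move=> [sT pT] [_ pT'] pA; apply: (bnd_of_form pA.1) => // x; first exact: pT.
by have := pT' p pA x; rewrite opadd opopp opid innerBr scale1r.
Qed.

(** Put v = Q x and a = <v, v>. As [theta x x] is below [H], the form at Q v gives a* a <= <Q v, H Q
    v>, and h (1 + h)^-2 <= 1/4 gives <Q v, H Q v> <= a / 4. Hence p(a) <= 1/4. *)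
Lemma seminormE_resolvent x p : opositive (H - theta x x) -> cstar_seminorms A p ->
  seminormE p (op Q x) <= 2^-1.
Proof.
move=> [_ Hx] pA; have pP := pA.1.
set v := op Q x; set a := inner v v : A.
have xQv : inner x (op Q v) = a by rewrite inner_opr sQ.
have h1 : pos p (inner (op Q v) (op H (op Q v)) - astar a ** a).
  have := Hx p pA (op Q v); rewrite opadd opopp thetaE innerBr innerMr xQv.
  by rewrite -[inner _ x]inner_star xQv.
have h2 : pos p (4^-1 *~: a - inner (op Q v) (op H (op Q v))).
  have -> : op H (op Q v) = v - op Q v by rewrite {2}[v]resolvent_apply; abelian.
  (* The inequality h (1 + h)^-2 <= 1/4 is the completed square of v / 2 - Q v. *)
  have := pos_inner pP (2^-1 *~: v - op Q v).
  rewrite !innerBr !innerBl !innerZr !innerZRl -/a scalerA -rmorphM/= (_ : 2^-1 * 2^-1 = 4^-1 :> R); last by field.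
  have -> : inner v (op Q v) = inner (op Q v) v by rewrite inner_opr sQ.
  set b := inner (op Q v) v; set c := inner (op Q v) (op Q v).
  have bb : b = 2^-1 *~: b + 2^-1 *~: b.
    by rewrite -scalerDl -rmorphD/= (_ : 2^-1 + 2^-1 = 1) ?scale1r//; field.
  suff -> : 4^-1 *~: a - (b - c) = 4^-1 *~: a - 2^-1 *~: b - (2^-1 *~: b - c) by [].
  by rewrite {1}bb; abelian.
have h3 : pos p (4^-1 *~: a - astar a ** a).
  have -> : 4^-1 *~: a - astar a ** a =
    (4^-1 *~: a - inner (op Q v) (op H (op Q v))) +
    (inner (op Q v) (op H (op Q v)) - astar a ** a) by abelian.
  exact: (posD pP).
have := pos_mono pP (pos_cstar pP a) h3; rewrite (cstar_sqr pP) (cstarZR pP) ger0_norm// => ha.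
apply: (seminormE_le pP) => //; rewrite -/a.
have := cstar_ge0 pP a; nra.
Qed.

End ResolventTheory.

(** Substituting Q1 = Q2 + Q1 D Q2 into Q1 - Q2 = Q2 D Q1 yields Q2 D Q2 + Q2 D Q1 D Q2, a sum of
    two positive operators; no commutation is involved. *)
Lemma resolvent_antitone H1 H2 Q1 Q2 : opositive H1 -> opositive (H2 - H1) ->
  resolvent_of H1 Q1 -> resolvent_of H2 Q2 -> opositive (Q1 - Q2).
Proof.
move=> pH1 [sD pD] HQ1 HQ2.
have [_ pQ1] := opositive_resolvent pH1 HQ1.
case: HQ1 HQ2 => [s1 HQ1 QH1] [s2 HQ2 QH2].
set D := H2 - H1 in sD pD.
have DE : D = (idop E + H2) - (idop E + H1) by rewrite /D; abelian.
have e1 : Q1 - Q2 = Q2 ** D ** Q1.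
  by rewrite DE amulBr amulBl QH2 amul1o -[in RHS]amulA HQ1 amulo1.
have e2 : Q1 - Q2 = Q1 ** D ** Q2.
  by rewrite DE amulBr amulBl QH1 amul1o -[in RHS]amulA HQ2 amulo1.
split=> [|p pA x]; first by rewrite astarB s1 s2.
have -> : Q1 - Q2 = Q2 ** (D ** Q2) + Q2 ** (D ** (Q1 ** (D ** Q2))).
  have e3 : Q1 = Q1 ** D ** Q2 + Q2 by rewrite -e2 subrK.
  by rewrite e1 {1}e3 amulDr addrC !amulA.
rewrite opadd innerDr !opmul !(inner_opr Q2) s2; apply: (posD pA.1); first exact: pD.
by rewrite inner_opr sD; exact: pQ1.
Qed.

End Resolvent.

(** * Compact operators *)

Section OperatorTopology.
Context {R : realType} {A : locallyCstarType R} {E : hilbertModType A}.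
Implicit Types (p : A -> R) (x y z : E) (S T D : operator E) (c d e r : R).

Let ball p T := [set seminormE p (op T x) | x in [set x : E | seminormE p x <= 1]].

Lemma opnorm_nonempty p T : cstar_seminorm setT p -> ball p T !=set0.
Proof. by move=> pP; exists (seminormE p (op T 0)), 0 => //=; rewrite (seminormE0 pP). Qed.

Lemma opnorm_le p T c : cstar_seminorm setT p -> 0 <= c -> bnd p T c -> opnorm p T <= c.
Proof.
move=> pP c0 Tc; apply: ge_sup; first exact: opnorm_nonempty.
by move=> _ [x /= x1 <-]; rewrite (le_trans (Tc x))// ler_piMr.
Qed.

(* When S is not bounded for p both suprema are 0 by convention. *)
Lemma opnormD_le p S D d : cstar_seminorm setT p -> 0 <= d -> bnd p D d ->
  opnorm p (S + D) <= opnorm p S + d.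
Proof.
move=> pP d0 Dd; have CS : cauchy_schwarz E p := hilbert_cauchy_schwarz pP.
have SD x : seminormE p x <= 1 -> seminormE p (op (S + D) x) <= seminormE p (op S x) + d /\
    seminormE p (op S x) <= seminormE p (op (S + D) x) + d.
  move=> x1; have Dx : seminormE p (op D x) <= d by rewrite (le_trans (Dd x))// ler_piMr.
  have := seminormE_dist pP CS (op (S + D) x) (op S x).
  have -> : op (S + D) x - op S x = op D x by rewrite opadd; abelian.
  by rewrite ler_norml => /andP[]; lra.
have [hS|hS] := pselect (has_ubound (ball p S)).
  apply: ge_sup; first exact: opnorm_nonempty.
  move=> _ [x /= x1 <-]; rewrite (le_trans (SD x x1).1)// lerD2r.
  by apply: ub_le_sup => //; exists x.
rewrite /opnorm -/(ball p S) -/(ball p (S + D)) !sup_out ?add0r//.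
  by move=> [].
move=> [_ [M SM]]; apply: hS; exists (M + d) => _ [x /= x1 <-].
by rewrite (le_trans (SD x x1).2)// lerD2r; apply: SM; exists x.
Qed.

Lemma opnormN p T : cstar_seminorm setT p -> opnorm p (- T) = opnorm p T.
Proof.
move=> pP; rewrite /opnorm; congr sup; apply/seteqP.
by split=> _ [x x1 <-]; exists x => //; rewrite opopp (seminormEN pP).
Qed.

Lemma nbhs_opball p S T e : cstar_seminorms A p -> opnorm p (T - S) < e ->
  nbhs T [set T' | opnorm p (T' - S) < e].
Proof.
move=> pA Te; rewrite nbhsE; exists [set T' | opnorm p (T' - S) < e] => //; split=> //.
set B := [set T' | _].
exists [set B]; last by rewrite bigcup_set1.
move=> _ ->; exists [fset B]%fset => /=.
  by move=> _ /fset1P ->; rewrite inE; exists p, S, e.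
apply/seteqP; split=> [T' H|T' BT' C]; first by apply: (H B) => /=; rewrite inE.
by rewrite /= inE => /eqP ->.
Qed.

Lemma opball_subbase (F : set_system (operator E)) T : Filter F ->
  (forall p S e, cstar_seminorms A p -> opnorm p (T - S) < e ->
    F [set T' | opnorm p (T' - S) < e]) -> F --> T.
Proof.
move=> FF FT U; rewrite nbhsE => -[B [[D sD DB] BT] BU].
apply: filterS BU _; move: BT; rewrite -DB => -[C DC CT].
have [D' sD' D'C] := sD _ DC.
apply: (@filterS _ F _ C) => [T' CT'|]; first by exists C.
move: CT; rewrite /= -D'C => CT; apply: filter_bigI => V VD'.
have : V \in @opballs R A E by exact: sD'.
have := CT V VD'; rewrite inE => VT [p [S [e [pA VE]]]].
by rewrite VE; apply: FT => //; move: VT; rewrite VE.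
Qed.

(** Subbasic balls need not be centred at [T]; the slack between the radius and the value at [T]
    absorbs a small perturbation. *)
Lemma bnd_cvg (F : set_system (operator E)) T : Filter F ->
  (forall p d, cstar_seminorms A p -> 0 < d -> F [set T' | bnd p (T' - T) d]) -> F --> T.
Proof.
move=> FF H; apply: opball_subbase => p S e pA Te.
pose d := (e - opnorm p (T - S)) / 2; have d0 : 0 < d by rewrite /d; lra.
apply: filterS (H p d pA d0) => T' /= T'd.
have -> : T' - S = (T - S) + (T' - T) by abelian.
by rewrite (le_lt_trans (opnormD_le _ pA.1 (ltW d0) T'd))// /d; lra.
Qed.

Lemma nbhs_op_translate T S (U : set (operator E)) : nbhs (T - S) U ->
  nbhs T [set T' | U (T' - S)].
Proof.
suff : (fun T' => T' - S) @ T --> T - S by apply.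
have FF : Filter ((fun T' => T' - S) @ T) by apply: fmap_filter; exact: nbhs_filter.
apply: opball_subbase => p S' e pA; rewrite -addrA -opprD => /(nbhs_opball pA).
by apply: filterS => T' /=; rewrite -addrA -opprD.
Qed.

Lemma nbhs_op_reflect T S (U : set (operator E)) : nbhs (S - T) U ->
  nbhs T [set T' | U (S - T')].
Proof.
suff : (fun T' => S - T') @ T --> S - T by apply.
have FF : Filter ((fun T' => S - T') @ T) by apply: fmap_filter; exact: nbhs_filter.
have e (T' S' : operator E) : S - T' - S' = - (T' - (S - S')) by abelian.
apply: opball_subbase => p S' d pA; rewrite e opnormN; last exact: pA.1.
move=> /(nbhs_opball pA); apply: filterS => T' /=.
by rewrite e opnormN//; exact: pA.1.
Qed.

End OperatorTopology.

(** * Finite rank operators and square roots inside K(E) *)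

Section FiniteRank.
Context {R : realType} {A : locallyCstarType R} {E : hilbertModType A}.
Implicit Types (p : A -> R) (x y z : E) (S T D F : operator E) (c d e r : R).

Local Notation K := (compact_operators E).

Lemma finite_rank_theta x y : finite_rank E (theta x y).
Proof.
by exists 1%N, (fun=> 1), (fun=> x), (fun=> y); rewrite big_ord1 scale1r.
Qed.

Lemma finite_rank0 : finite_rank E 0.
Proof. by exists 0%N, (fun=> 0), (fun=> 0), (fun=> 0); rewrite big_ord0. Qed.

Lemma finite_rankD S T : finite_rank E S -> finite_rank E T -> finite_rank E (S + T).
Proof.
move=> [n [c [x [y ->]]]] [m [d [z [t ->]]]].
pose f U (g : 'I_n -> U) (h : 'I_m -> U) (i : 'I_(n + m)) :=
  match fintype.split i with inl j => g j | inr k => h k end.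
exists (n + m)%N, (f _ c d), (f _ x z), (f _ y t).
rewrite big_split_ord/=; congr (_ + _); apply: eq_bigr => i _; rewrite /f.
  by case: split_ordP => j /eqP; rewrite ?eq_shift// => /eqP ->.
by case: split_ordP => j /eqP; rewrite ?eq_shift// => /eqP ->.
Qed.

Lemma finite_rankZ (c : R[i]) T : finite_rank E T -> finite_rank E (c *: T).
Proof.
move=> [n [d [x [y ->]]]]; exists n, (fun i => c * d i), x, y.
by rewrite scaler_sumr; apply: eq_bigr => i _; rewrite scalerA.
Qed.

Lemma finite_rankN T : finite_rank E T -> finite_rank E (- T).
Proof. by rewrite -scaleN1r; exact: finite_rankZ. Qed.

Lemma finite_rankB S T : finite_rank E S -> finite_rank E T -> finite_rank E (S - T).
Proof. by move=> fS fT; apply: finite_rankD => //; exact: finite_rankN. Qed.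

Lemma finite_rank_ind (P : operator E -> Prop) : P 0 ->
  (forall S T, P S -> P T -> P (S + T)) -> (forall (c : R[i]) x y, P (c *: theta x y)) ->
  forall T, finite_rank E T -> P T.
Proof.
by move=> P0 PD Pt T [n [c [x [y ->]]]]; apply: big_ind => // i _; exact: Pt.
Qed.

Lemma finite_rankMl S T : finite_rank E T -> finite_rank E (S ** T).
Proof.
move: T; apply: finite_rank_ind => [|T T' fT fT'|c x y].
- by rewrite amulr0; exact: finite_rank0.
- by rewrite amulDr; exact: finite_rankD.
- by rewrite amulZr amul_theta; apply: finite_rankZ; exact: finite_rank_theta.
Qed.

Lemma finite_rankMr S T : finite_rank E T -> finite_rank E (T ** S).
Proof.
move: T; apply: finite_rank_ind => [|T T' fT fT'|c x y].
- by rewrite amul0r; exact: finite_rank0.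
- by rewrite amulDl; exact: finite_rankD.
- by rewrite amulZl theta_amul; apply: finite_rankZ; exact: finite_rank_theta.
Qed.

Lemma finite_rank_compact T : finite_rank E T -> K T.
Proof. exact: subset_closure. Qed.

Lemma compact_subl T F : K T -> finite_rank E F -> K (F - T).
Proof.
move=> KT fF U /nbhs_op_reflect/KT[F' [fF' UF']]; exists (F - F'); split=> //.
exact: finite_rankB.
Qed.

Lemma compactN T : K T -> K (- T).
Proof. by move=> KT; rewrite -sub0r; apply: compact_subl => //; exact: finite_rank0. Qed.

(* A square root of a positive finite rank contraction, as a limit of Visser's
   iteration; removing the constant terms makes the approximants finite rank. *)
Lemma positive_finite_rank T : finite_rank E T -> opositive T -> opositive (idop E - T) ->
  Defs.positive K T.
Proof.
move=> fT pT pT'; have sT := pT.1.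
pose W : {poly R} := 1 - 'X.
have W1 p : cstar_seminorms A p -> bnd p (ev T W) 1.
  move=> pA; rewrite /W evB ev1 evX.
  by apply: (@bnd_01 _ _ _ _ p) => //; rewrite subKr.
pose Y n := ev T (sqiter W n).
have YY p n m : cstar_seminorms A p -> (n <= m)%N -> bnd p (Y m - Y n) (@sqt R m - @sqt R n).
  move=> pA /subnKC <-; have pP := pA.1.
  elim: (m - n)%N => [|k IH]; first by rewrite addn0 !subrr; exact: (bnd0 pP).
  rewrite addnS; set N := (n + k)%N in IH *.
  have -> : Y N.+1 - Y n = (Y N.+1 - Y N) + (Y N - Y n) by abelian.
  have -> : @sqt R N.+1 - @sqt R n = (@sqt R N.+1 - @sqt R N) + (@sqt R N - @sqt R n) by abelian.
  apply: (bndD pP (hilbert_cauchy_schwarz pP)) => //.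
  by rewrite -evB; apply: bnd_sqiterS => //; [exact: hilbert_cauchy_schwarz|exact: W1].
have [|p e pA e0|L sL LP] := @operator_limit _ _ E Y.
- by move=> n; exact: ev_star.
- have [N NP] := sqt_cvg e0; exists N => n m Nn nm.
  apply: bnd_le (YY p n m pA nm); have := NP n Nn; have := @sqt_le1 R m; lra.
pose c := idop E - L.
have sc : astar c = c by rewrite astarB astar_idop sL.
exists c; last first.
  rewrite sc; apply/esym/operator_eq => x; apply/subr0_eq/seminormE_small_eq0 => p e pA e0.
  have pP := pA.1; have CS : cauchy_schwarz E p := hilbert_cauchy_schwarz pP.
  have x0 := seminormE_ge0 (p := p) x.
  have d0 : 0 < 7 * (seminormE p x + 1) by lra.
  (* The error of c^2 is at most 6 e' + e'^2, which is at most 7 e' because e' <= 1. *)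
  pose e' := Num.min 1 (e / (7 * (seminormE p x + 1))).
  have e'0 : 0 < e' by rewrite lt_min ltr01 divr_gt0.
  have e'1 : e' <= 1 by rewrite ge_min lexx.
  have e'e : 7 * e' * seminormE p x <= e.
    apply: (@le_trans _ _ (e' * (7 * (seminormE p x + 1)))); first by nra.
    by rewrite -ler_pdivlMr// ge_min lexx orbT.
  have [N1 LN] := LP p e' pA e'0; have [N2 tN] := sqt_cvg e'0.
  pose n := maxn N1 N2; have {}LN := LN n (leq_maxl _ _); have {}tN := tN n (leq_maxr _ _).
  pose s := ev T (1 - sqiter W n); pose D := Y n - L.
  have s2 : bnd p s 2.
    rewrite /s evB ev1 (_ : 2 = 1 + 1)//; apply: (bndB pP CS); first exact: bnd_id.
    exact: (bnd_le (sqt_le1 n) (bnd_sqiter pP CS n (W1 p pA))).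
  have cE : c = s + D by rewrite /c /s /D evB ev1 -/(Y n); abelian.
  have ss : bnd p (s ** s - T) (2 * e').
    rewrite /s -ev_sqr -[in X in _ - X](evX T) -evB sqiter_sqr.
    have -> : 1 - W + 2 *: (sqiter W n.+1 - sqiter W n) - 'X =
      2 *: (sqiter W n.+1 - sqiter W n) by rewrite /W; abelian.
    rewrite evZ -[2 in X in bnd _ _ X]ger0_norm//; apply: (bndZR pP).
    apply: bnd_le (bnd_sqiterS pP CS n (W1 p pA)).
    have := @sqt_le1 R n.+1; lra.
  have ccT : bnd p (c ** c - T) (7 * e').
    have -> : c ** c - T = (s ** D + D ** s) + (D ** D + (s ** s - T)).
      by rewrite cE !amulDl !amulDr; abelian.
    apply: (@bnd_le _ _ _ _ _ ((2 * e' + e' * 2) + (e' * e' + 2 * e'))); first by nra.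
    by do !apply: (bndD pP CS) => //; apply: bndM => //; exact: ltW.
  exact: le_trans (ccT x) e'e.
(* The constant term of the n-th iterate is [sqt n], since W has constant term 1. The induction uses
   1 - W = T and factors the difference of squares. *)
have fY n : finite_rank E (@sqt R n *~: idop E - Y n).
  elim: n => [|n IH].
    rewrite /Y /= ev0 subr0 scale0r; exact: finite_rank0.
  have -> : @sqt R n.+1 *~: idop E - Y n.+1 = 2^-1 *~:
     (T + (@sqt R n *~: idop E - Y n) ** (@sqt R n *~: idop E + Y n)).
    rewrite /Y -!(evC T) -evB -evD -[X in X + _ ** _](evX T) -evB -evM -evD -evZ.
    congr ev; rewrite /= /W mulrC rmorphM rmorphD rmorphXn/= -!mul_polyC.
    by rewrite polyC1; ring.
  apply: finite_rankZ; apply: finite_rankD => //; exact: finite_rankMr.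
have : (fun n => @sqt R n *~: idop E - Y n) @ \oo --> c.
  apply: bnd_cvg => p d pA d0; have pP := pA.1.
  have d2 : 0 < d / 2 by rewrite divr_gt0.
  have [N1 LN] := LP p _ pA d2; have [N2 tN] := sqt_cvg d2.
  exists (maxn N1 N2) => // n; rewrite /= geq_max => /andP[n1 n2].
  have -> : @sqt R n *~: idop E - Y n - c =
      - ((1 - @sqt R n) *~: idop E) - (Y n - L).
    have -> : (1 - @sqt R n) *~: idop E = idop E - @sqt R n *~: idop E.
      by rewrite rmorphB/= scalerBl scale1r.
    by rewrite /c; abelian.
  apply: (@bnd_le _ _ _ _ _ ((1 - @sqt R n) + d / 2)); first by have := tN n n2; lra.
  apply: (bndB pP (hilbert_cauchy_schwarz pP)); last exact: LN.
  by apply: (bndN pP); apply: (bnd_idZ pP); have := @sqt_le1 R n; lra.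
move=> cvgc U /cvgc[N _ NU]; exists (@sqt R N *~: idop E - Y N); split=> //.
by apply: NU => /=.
Qed.

End FiniteRank.

(** * Arbitrary continuous C*-seminorms on K(E) *)

Section CompactSeminorms.
Context {R : realType} {A : locallyCstarType R} {E : hilbertModType A}.
Implicit Types (p : A -> R) (x y z : E) (S T D F : operator E) (c d e r : R).

Local Notation K := (compact_operators E).
Context {P : operator E -> R} (PP : continuous_cstar_seminorms K P).

Let P0 : P 0 = 0.
Proof. exact: (cstar_seminorm0 PP.1 (finite_rank_compact finite_rank0)). Qed.

Let P_ge0 T : K T -> 0 <= P T.
Proof. by move=> KT; exact: (cstar_seminorm_ge0 PP.1 compactN). Qed.

Lemma compact_seminorm_near0 e : 0 < e -> nbhs (0 : operator E) [set T | K T -> P T < e].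
Proof.
move=> e0; have K0 : K 0 := finite_rank_compact finite_rank0.
have : P @ (nbhs (0 : subspace K)) --> P 0 := PP.2 0.
rewrite P0 => /cvgr0Pnorm_lt/(_ e e0).
have -> : nbhs (0 : subspace K) = within K (nbhs (0 : operator E)).
  by case: (nbhs_subspaceP K 0).
move=> H; have {}H : nbhs (0 : operator E) [set T | K T -> `|P T| < e] := H.
by apply: filterS H => T /= h KT; have := h KT; rewrite ger0_norm//; exact: P_ge0.
Qed.

Lemma compact_seminorm_approx T e : K T -> 0 < e -> exists2 F, finite_rank E F & P (F - T) < e.
Proof.
move=> KT e0; have := compact_seminorm_near0 e0; rewrite -{1}(subrr T).
move=> /nbhs_op_translate/KT[F [fF FP]]; exists F => //.
by apply: FP; exact: compact_subl.
Qed.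

(** The filter of sets containing all operators of uniformly small bound converges to 0, so
    continuity of [P] at 0 gives P < 1 on the finite rank operators of some bound d; homogeneity
    does the rest. *)
Lemma compact_seminorm_bound : exists2 c, 0 < c & forall T, finite_rank E T ->
  (forall p, cstar_seminorms A p -> bnd p T 1) -> P T <= c.
Proof.
pose F : set_system (operator E) := [set U | exists2 d, 0 < d &
  forall T, (forall p, cstar_seminorms A p -> bnd p T d) -> U T].
have FF : Filter F.
  split; first by exists 1.
    move=> U V [d d0 Ud] [e e0 Ve]; exists (Num.min d e); first by rewrite lt_min d0.
    by move=> T Tde; split; [apply: Ud|apply: Ve] => p pA; apply: bnd_le (Tde p pA);
      rewrite ge_min lexx ?orbT.
  by move=> U V UV [d d0 Ud]; exists d => // T /Ud/UV.
have F0 : F --> (0 : operator E).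
  apply: bnd_cvg => p d pA d0; exists d => // T /(_ p pA) /=.
  by rewrite subr0.
have [d d0 Pd] := F0 _ (compact_seminorm_near0 ltr01).
exists d^-1; rewrite ?invr_gt0// => T fT T1.
have fdT : finite_rank E (d *~: T) by exact: finite_rankZ.
have /= := Pd (d *~: T) _ (finite_rank_compact fdT).
rewrite (cstar_seminormZR PP.1); last exact: finite_rank_compact.
rewrite gtr0_norm// mulrC -ltr_pdivlMr// div1r => H; apply/ltW/H => p pA.
by rewrite -[d]mulr1 -{2}[d]gtr0_norm// mulr1; have := bndZR pA.1 d (T1 p pA); rewrite mulr1.
Qed.

(** By the C*-identity repeated squaring of [T] squares [P]. If P(T) exceeded 1 these values would
    grow without limit, against the uniform bound on finite rank contractions. *)
Lemma compact_seminorm_le1 T : finite_rank E T -> astar T = T ->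
  (forall p, cstar_seminorms A p -> bnd p T 1) -> P T <= 1.
Proof.
move=> fT sT T1; have [c c0 cP] := compact_seminorm_bound.
pose T_ n := iter n (fun S => S ** S) T.
have T_P n : [/\ finite_rank E (T_ n), astar (T_ n) = T_ n &
    forall p, cstar_seminorms A p -> bnd p (T_ n) 1].
  elim: n => [//|n [fTn sTn Tn1]] /=; split; first exact: finite_rankMl.
    by rewrite astarM sTn.
  by move=> p pA; rewrite -[1]mulr1; apply: bndM => //; exact: Tn1.
have PTS n : P (T_ n.+1) = P (T_ n) ^+ 2.
  have [fTn sTn _] := T_P n; rewrite /= -/(T_ n) -{1}sTn.
  by apply: (cstar_seminorm_star PP.1); exact: finite_rank_compact.
have [//|PT1] := leP (P T) 1; exfalso.
pose d := P T - 1; have d0 : 0 < d by rewrite /d; lra.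
have growth n : 1 + n.+1%:R * d <= P (T_ n).
  elim: n => [|n IH]; first by rewrite mul1r /d /=; lra.
  rewrite PTS -natr1 mulrDl mul1r.
  have : 0 <= n%:R * d by rewrite mulr_ge0// ltW.
  have -> : n.+1%:R * d = n%:R * d + d by rewrite -natr1 mulrDl mul1r.
  by move: IH; rewrite -natr1 mulrDl mul1r; move: (n%:R * d) (P (T_ n)) => u v; nra.
have [fTn _ Tn1] := T_P (Num.truncn (c / d)).
have := cP _ fTn Tn1; apply/negP; rewrite -ltNge.
apply: lt_le_trans (growth _); rewrite ltr_wpDl// -ltr_pdivrMr//.
exact: truncnS_gt.
Qed.

(* [m n T] stands for T e_n or e_n T. *)
Lemma compact_seminorm_cvg (m : nat -> operator E -> operator E) T :
  (forall n S S', m n (S - S') = m n S - m n S') ->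
  (forall n S, finite_rank E (m n S)) ->
  (forall n S, K S -> P (m n S) <= P S) ->
  (forall F, finite_rank E F -> (fun n => m n F - F) @ \oo --> (0 : operator E)) ->
  K T -> P (m n T - T) @[n --> \oo] --> (0 : R).
Proof.
move=> mB fm mP mF KT; apply/cvgr0Pnorm_lt => e e0.
have e3 : 0 < e / 3 by rewrite divr_gt0.
have [F fF FT] := compact_seminorm_approx KT e3.
have KFT := compact_subl KT fF.
have [N _ NF] := mF F fF _ (compact_seminorm_near0 e3); exists N => // n /NF /=.
have fmF : finite_rank E (m n F - F) by exact: finite_rankB.
move=> /(_ (finite_rank_compact fmF)) h.
have KmT : K (m n T - T).
  apply: compact_subl => //; exact: fm.
rewrite ger0_norm ?P_ge0//.
have -> : m n T - T = (m n F - F) - (m n (F - T) - (F - T)) by rewrite mB; abelian.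
have K1 := finite_rank_compact fmF.
have K2 : K (m n (F - T)) := finite_rank_compact (fm n _).
have K3 : K (m n (F - T) - (F - T)) by apply: compact_subl.
have := cstar_seminormB PP.1 compactN K1 K3.
have := cstar_seminormB PP.1 compactN K2 KFT.
have := mP n (F - T) KFT.
lra.
Qed.

End CompactSeminorms.

(** * Countable approximate units *)

Section CountableApproximateUnit.
Context {R : realType} {A : locallyCstarType R} {E : hilbertModType A}.
Implicit Types (p : A -> R) (x y z : E) (S T D F : operator E) (c d e r : R).

Local Notation K := (compact_operators E).

Lemma generating_ind (G M : set E) : generating G -> @submodule R A E M -> closed M -> G `<=` M ->
  forall x, M x.
Proof.
move=> gG sM cM GM x; have : [set: E] x by [].
by rewrite -gG; apply; split.
Qed.

Lemma countable_enum (G : set E) : countable G -> exists x : nat -> E, forall y, G y ->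
  exists n, x n = y.
Proof.
(* Indices that code no element of [G] yield the vector 0; this also covers finite and empty [G]. *)
move=> /countable_injP[g gI]; exists (fun n => xget 0 [set y | G y /\ g y = n]) => y Gy.
exists (g y); have /= [Gx gx] := xgetPex 0 (ex_intro [set z | G z /\ g z = g y] y (conj Gy erefl)).
by apply: gI; rewrite ?inE.
Qed.

Variable x : nat -> E.

Definition gensum n : operator E := \sum_(k < n) n%:R *~: theta (x k) (x k).

Lemma opositive_sum n (c : 'I_n -> R) (y : 'I_n -> E) (I : pred 'I_n) : (forall i, I i -> 0 <= c i) ->
  opositive (\sum_(i < n | I i) c i *~: theta (y i) (y i)).
Proof.
move=> c0; apply: big_ind; first exact: opositive0.
  by move=> S T; exact: opositiveD.
by move=> i Ii; apply: opositiveZ; [exact: c0|exact: opositive_theta].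
Qed.

Lemma opositive_gensum n : opositive (gensum n).
Proof. exact: opositive_sum. Qed.

Lemma finite_rank_gensum n : finite_rank E (gensum n).
Proof. by exists n, (fun=> n%:R%:C), (fun k : 'I_n => x k), (fun k : 'I_n => x k). Qed.

Lemma obounded_gensum n : obounded (gensum n).
Proof.
apply: big_ind.
- by move=> p pA; exists 0 => //; exact: (bnd0 pA.1).
- by move=> S T; exact: oboundedD.
- by move=> i _; apply: oboundedZ; exact: obounded_theta.
Qed.

Lemma gensum_mono n m : (n <= m)%N -> opositive (gensum m - gensum n).
Proof.
move=> nm; rewrite /gensum (big_ord_widen m (fun k => n%:R *~: theta (x k) (x k)) nm).
rewrite [X in _ - X]big_mkcond/= -sumrB.
have -> : \sum_(i < m) (m%:R *~: theta (x i) (x i) -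
    (if (i < n)%N then n%:R *~: theta (x i) (x i) else 0)) =
  \sum_(i < m) (m%:R - (if (i < n)%N then n%:R else 0)) *~: theta (x i) (x i).
  apply: eq_bigr => i _; case: ifP => _; last by rewrite !subr0.
  by rewrite rmorphB/= scalerBl.
apply: opositive_sum => i _; case: ifP => _; last by rewrite subr0.
by rewrite subr_ge0 ler_nat.
Qed.

(** Moving the weight n into the vector puts the domination in the form required by
    [seminormE_resolvent], which then bounds sqrt(n) times Q_n x_k by 1/2. *)
Lemma gensum_theta n k : (k < n)%N ->
  opositive (gensum n - theta (Num.sqrt n%:R *~: x k) (Num.sqrt n%:R *~: x k)).
Proof.
move=> kn; rewrite /gensum (bigD1 (Ordinal kn))//=.
have -> : theta (Num.sqrt n%:R *~: x k) (Num.sqrt n%:R *~: x k) = n%:R *~: theta (x k) (x k).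
  apply: operator_eq => z; rewrite opscale !thetaE innerZRl ractZl ractZr scalerA.
  by rewrite -rmorphM/= -expr2 sqr_sqrtr.
by rewrite addrAC subrr add0r; exact: opositive_sum.
Qed.

Variable Q : nat -> operator E.
Hypothesis HQ : forall n, resolvent_of (gensum n) (Q n).

Let oQ n : opositive (Q n) := opositive_resolvent (opositive_gensum n) (HQ n).
Let oQ' n : opositive (idop E - Q n) := opositive_1B_resolvent (opositive_gensum n) (HQ n).
Let sQ n : astar (Q n) = Q n := (oQ n).1.

Let Q1 n p : cstar_seminorms A p -> bnd p (Q n) 1.
Proof. by move=> pA; exact: bnd_01. Qed.

(** Equivalent to e_n y -> y. The vectors with this property form a closed submodule, so the
    generators suffice. *)
Definition vanishes y := forall p d, cstar_seminorms A p -> 0 < d ->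
  exists N, forall n, (N <= n)%N -> seminormE p (op (Q n) y) <= d.

Lemma vanishes_gen k : vanishes (x k).
Proof.
(* Beyond this index sqrt(n) >= 1 / (2 d), which turns the bound 1/2 into d. *)
move=> p d pA d0; exists (maxn k.+1 (Num.truncn ((2 * d) ^- 2)).+1) => n.
rewrite geq_max => /andP[kn Nn]; have pP := pA.1.
have := seminormE_resolvent (HQ n) (gensum_theta kn) pA.
rewrite opZ (seminormEZR pP) ger0_norm ?sqrtr_ge0// => h.
have d2 : 0 < 2 * d by lra.
have sn : (2 * d)^-1 <= Num.sqrt n%:R.
  rewrite -[X in X <= _]gtr0_norm ?invr_gt0// -sqrtr_sqr ler_wsqrtr// exprVn.
  by rewrite (le_trans (ltW (truncnS_gt _)))// ler_nat.
have q0 := seminormE_ge0 (p := p) (op (Q n) (x k)).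
have : (2 * d)^-1 * seminormE p (op (Q n) (x k)) <= 2^-1.
  by rewrite (le_trans _ h)// ler_wpM2r.
rewrite mulrC ler_pdivrMr// => /le_trans; apply.
by rewrite mulrA mulVf ?mul1r// pnatr_eq0.
Qed.

Lemma submodule_vanishes : @submodule R A E vanishes.
Proof.
split=> [p d pA d0|y z vy vz p d pA d0|c y vy p d pA d0|y a vy p d pA d0].
- by exists 0%N => n _; rewrite op0 (seminormE0 pA.1) ltW.
- have d2 : 0 < d / 2 by rewrite divr_gt0.
  have [N1 yN] := vy p _ pA d2; have [N2 zN] := vz p _ pA d2.
  exists (maxn N1 N2) => n; rewrite geq_max => /andP[n1 n2].
  rewrite opD (le_trans (seminormED pA.1 (hilbert_cauchy_schwarz pA.1) _ _))//.
  by have := yN n n1; have := zN n n2; lra.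
- have c0 : 0 <= Normc.normc c by case: c => a b /=; exact: sqrtr_ge0.
  have c1 : 0 < Normc.normc c + 1 by lra.
  have [N yN] := vy p _ pA (divr_gt0 d0 c1).
  exists N => n /yN h; rewrite opZ (seminormEZ pA.1).
  have := ler_wpM2l c0 h; move=> /le_trans; apply.
  by rewrite mulrCA ger_pMr// ler_pdivrMr// mul1r; lra.
- have c0 := cstar_ge0 pA.1 a.
  have c1 : 0 < p a + 1 by lra.
  have [N yN] := vy p _ pA (divr_gt0 d0 c1).
  exists N => n /yN h; rewrite op_ract (le_trans (seminormE_ract pA.1 _ _))//.
  have := ler_wpM2r c0 h; move=> /le_trans; apply.
  by rewrite mulrAC ler_pdivrMr// ler_wpM2l ?(ltW d0)//; lra.
Qed.

(** The resolvents are contractions for every seminorm, so an approximation of z is not amplified,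
    uniformly in n. *)
Lemma closed_vanishes : closed vanishes.
Proof.
move=> z cz p d pA d0; have d2 : 0 < d / 2 by rewrite divr_gt0.
have [m vm mz] := closure_seminormE cz pA d2.
have [N mN] := vm p _ pA d2; exists N => n /mN h.
have -> : op (Q n) z = op (Q n) m - op (Q n) (m - z) by rewrite opB; abelian.
rewrite (le_trans (seminormEB pA.1 (hilbert_cauchy_schwarz pA.1) _ _))//.
by have := Q1 n pA (m - z); lra.
Qed.

Hypothesis Qv : forall y, vanishes y.

Lemma finite_rank_vanishes F p d : finite_rank E F -> cstar_seminorms A p -> 0 < d ->
  exists N, forall n, (N <= n)%N -> bnd p (Q n ** F) d.
Proof.
move=> fF pA; have pP := pA.1; have CS : cauchy_schwarz E p := hilbert_cauchy_schwarz pP.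
move: F fF d; apply: finite_rank_ind => [d d0|F F' FN FN' d d0|c y z d d0].
- by exists 0%N => n _; rewrite amulr0; apply: (bnd0 pP); exact: ltW.
- have d2 : 0 < d / 2 by rewrite divr_gt0.
  have [N1 N1P] := FN _ d2; have [N2 N2P] := FN' _ d2.
  exists (maxn N1 N2) => n; rewrite geq_max => /andP[n1 n2].
  rewrite amulDr (_ : d = d / 2 + d / 2); last by field.
  by apply: (bndD pP CS); [exact: N1P|exact: N2P].
- have z0 := seminormE_ge0 (p := p) z.
  have c0 : 0 <= Normc.normc c by case: c => a b /=; exact: sqrtr_ge0.
  pose b := (Normc.normc c + 1) * (seminormE p z + 1).
  have b0 : 0 < b by rewrite mulr_gt0//; lra.
  have [N yN] := @Qv y p _ pA (divr_gt0 d0 b0); exists N => n /yN h.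
  rewrite amulZr amul_theta.
  apply: bnd_le (bndZ pP c (bnd_theta _ _ pP)).
  have h' : seminormE p (op (Q n) y) * seminormE p z <= d / b * (seminormE p z + 1).
    by apply: ler_pM => //; [exact: seminormE_ge0|lra].
  apply: (le_trans (ler_wpM2l c0 h')).
  have -> : Normc.normc c * (d / b * (seminormE p z + 1)) =
    d * (Normc.normc c * (seminormE p z + 1) / b) by ring.
  rewrite ger_pMr// ler_pdivrMr// mul1r /b ler_wpM2r//; lra.
Qed.

Lemma finite_rank_vanishes_r F p d : finite_rank E F -> cstar_seminorms A p -> 0 < d ->
  exists N, forall n, (N <= n)%N -> bnd p (F ** Q n) d.
Proof.
move=> fF pA d0.
have fF' : finite_rank E (astar F).
  move: F fF; apply: finite_rank_ind => [|F F' fF fF'|c y z].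
  - by rewrite astar0; exact: finite_rank0.
  - by rewrite astarD; exact: finite_rankD.
  - by rewrite astarZ astar_theta; apply: finite_rankZ; exact: finite_rank_theta.
have [N FN] := finite_rank_vanishes fF' pA d0; exists N => n /FN h.
rewrite -[_ ** _]astarK astarM sQ.
exact: (bnd_star pA.1 (hilbert_cauchy_schwarz pA.1) (ltW d0) h).
Qed.

Let e_ n : operator E := idop E - Q n.

Lemma finite_rank_unit n : finite_rank E (e_ n).
Proof.
(* From (1 + h) Q = 1; the right-hand side visibly has finite rank. *)
have -> : e_ n = gensum n ** Q n.
  case: (HQ n) => _ h _; rewrite /e_ -{1}h amulDl amul1o; abelian.
by apply: finite_rankMr; exact: finite_rank_gensum.
Qed.

Lemma approximate_unit_resolvents : approximate_unit K (fun n m : nat => (n <= m)%N) e_.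
Proof.
have se n : astar (e_ n) = e_ n := (oQ' n).1.
split.
- split=> [|n|n m k|n m]; [exact: inhabits 0%N|exact: leqnn|exact: leq_trans|].
  by exists (maxn n m); rewrite leq_maxl leq_maxr.
- by move=> n; apply: finite_rank_compact; exact: finite_rank_unit.
- move=> n; apply: positive_finite_rank; [exact: finite_rank_unit|exact: oQ'|].
  by rewrite /e_ subKr.
- move=> n m nm; have -> : e_ m - e_ n = Q n - Q m by rewrite /e_; abelian.
  apply: positive_finite_rank.
  + have -> : Q n - Q m = e_ m - e_ n by rewrite /e_; abelian.
    by apply: finite_rankB; exact: finite_rank_unit.
  + exact: (resolvent_antitone (opositive_gensum n) (gensum_mono nm) (HQ n) (HQ m)).
  + have -> : idop E - (Q n - Q m) = e_ n + Q m by rewrite /e_; abelian.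
    exact: opositiveD (oQ' n) (oQ m).
- move=> P PP n; apply: (compact_seminorm_le1 PP) => //; first exact: finite_rank_unit.
  by move=> p pA; apply: bnd_01 pA; [exact: oQ'|rewrite /e_ subKr; exact: oQ].
- move=> P T PP KT.
  have Pe n : P (e_ n) <= 1.
    apply: (compact_seminorm_le1 PP) => //; first exact: finite_rank_unit.
    by move=> p pA; apply: bnd_01 pA; [exact: oQ'|rewrite /e_ subKr; exact: oQ].
  have Ke n : K (e_ n) by apply: finite_rank_compact; exact: finite_rank_unit.
  have Pge S : K S -> 0 <= P S.
    by move=> KS; exact: (cstar_seminorm_ge0 PP.1 compactN).
  split.
  + apply: (compact_seminorm_cvg PP (m := fun n S => S ** e_ n)) => //.
    * by move=> n S S'; rewrite amulBl.
    * by move=> n S; apply: finite_rankMl; exact: finite_rank_unit.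
    * move=> n S KS; rewrite (le_trans (cstar_seminormM PP.1 KS (Ke n)))//.
      by rewrite ler_piMr// Pge.
    * move=> F fF; apply: bnd_cvg => p d pA d0.
      have [N FN] := finite_rank_vanishes_r fF pA d0; exists N => // n /FN h /=.
      by rewrite subr0 /e_ amulBr amulo1 addrAC subrr add0r; exact: (bndN pA.1).
  + apply: (compact_seminorm_cvg PP (m := fun n S => e_ n ** S)) => //.
    * by move=> n S S'; rewrite amulBr.
    * by move=> n S; apply: finite_rankMr; exact: finite_rank_unit.
    * move=> n S KS; rewrite (le_trans (cstar_seminormM PP.1 (Ke n) KS))//.
      by rewrite ler_piMl// Pge.
    * move=> F fF; apply: bnd_cvg => p d pA d0.
      have [N FN] := finite_rank_vanishes fF pA d0; exists N => // n /FN h /=.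
      by rewrite subr0 /e_ amulBl amul1o addrAC subrr add0r; exact: (bndN pA.1).
Qed.

End CountableApproximateUnit.

Lemma countably_generated_unit (R : realType) (A : locallyCstarType R) (E : hilbertModType A) :
  countably_generated E -> has_countable_approximate_unit (compact_operators E).
Proof.
move=> [G [cG gG]]; have [x xP] := countable_enum cG.
have /choice[Q HQ] n : exists Q, resolvent_of (gensum x n) Q.
  by apply: resolvent_ex; [exact: opositive_gensum|exact: obounded_gensum].
exists nat, (fun n m : nat => (n <= m)%N), (fun n => idop E - Q n).
split; first exact: countableP.
apply: (approximate_unit_resolvents HQ) => y.
apply: (generating_ind gG (M := vanishes Q)).
- exact: submodule_vanishes.
- exact: closed_vanishes HQ.
- by move=> _ /xP[k <-]; exact: vanishes_gen HQ k.
Qed.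

(** * Boundedness of adjointable operators *)

Section Boundedness.
Context {R : realType} {A : locallyCstarType R} {E : hilbertModType A}.
Implicit Types (p q : A -> R) (x y z : E) (T : operator E) (c d e r : R).

Definition unit_ball : set E := [set x | forall q, cstar_seminorms A q -> seminormE q x <= 1].

(* Sokal's proof of the uniform boundedness principle: [s n.+1 = s n +- 3^-n w n]
   with the sign making [f n (s n.+1)] at least [3^-n f n (w n)]. *)
Lemma gliding_hump (f : nat -> E -> R) (w : nat -> E) (M : nat -> R) :
  (forall n x y, f n (x + y) <= f n x + f n y) ->
  (forall n r x, f n (r *~: x) = `|r| * f n x) ->
  (forall n, unit_ball (w n)) ->
  (forall n x, unit_ball x -> f n x <= M n) ->
  (forall n, 2 / 3 * M n <= f n (w n)) ->
  exists x, forall n, (3 ^- n) / 6 * M n <= f n x.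
Proof.
move=> fD fZ wU fM fw.
pose fix s n : E := if n is m.+1 then
  let u := (3 ^- m) *~: w m in
  if f m (s m - u) <= f m (s m + u) then s m + u else s m - u else 0.
have g0 n : 0 < 3 ^- n :> R by rewrite invr_gt0 exprn_gt0.
have fN n x : f n (- x) = f n x.
  have := fZ n (-1) x; rewrite rmorphN1 scaleN1r => ->.
  by rewrite normrN normr1 mul1r.
have fs n : 3 ^- n * f n (w n) <= f n (s n.+1).
  rewrite /=; set u := _ *~: w n.
  have fu : f n u = 3 ^- n * f n (w n) by rewrite fZ gtr0_norm.
  clearbody u.
  have : f n u + f n u <= f n (s n + u) + f n (s n - u).
    have -> : f n u + f n u = f n (2 *~: u) by rewrite fZ ger0_norm//; ring.
    have -> : 2 *~: u = (s n + u) + - (s n - u) by rewrite scale2; abelian.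
    by rewrite (le_trans (fD _ _ _))// fN.
  by rewrite fu; case: (leP (f n (s n - u)) (f n (s n + u))) => ? ?; lra.
have ss q n : cstar_seminorms A q -> seminormE q (s n.+1 - s n) <= 3 ^- n.
  move=> qA; have uq : seminormE q ((3 ^- n) *~: w n) <= 3 ^- n.
    rewrite (seminormEZR qA.1) gtr0_norm// ger_pMr//; exact: wU.
  rewrite /=; case: ifP => _; first by rewrite addrAC subrr add0r.
  by rewrite addrAC subrr add0r (seminormEN qA.1).
have smn q n k : cstar_seminorms A q ->
    seminormE q (s (n + k)%N - s n) <= 3 / 2 * 3 ^- n - 3 / 2 * 3 ^- (n + k).
  move=> qA; elim: k => [|k IH]; first by rewrite addn0 !subrr (seminormE0 qA.1).
  rewrite addnS; set N := (n + k)%N in IH *.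
  have -> : s N.+1 - s n = (s N.+1 - s N) + (s N - s n) by abelian.
  rewrite (le_trans (seminormED qA.1 (hilbert_cauchy_schwarz qA.1) _ _))//.
  have := ss q N qA; rewrite exprSr invfM.
  by move: (3 ^- N) IH => u; lra.
have smn' q n m : cstar_seminorms A q -> (n <= m)%N -> seminormE q (s m - s n) <= 3 / 2 * 3 ^- n.
  move=> qA /subnKC <-; have := smn q n (m - n)%N qA.
  by have := g0 (n + (m - n))%N; move: (3 ^- (n + (m - n))) => u; lra.
have g_small e : 0 < e -> exists N, forall n, (N <= n)%N -> 3 / 2 * 3 ^- n < e.
  move=> e0; exists (Num.truncn (3 / 2 / e)).+1 => n Nn.
  have n3 : n%:R <= 3 ^+ n :> R.
    by rewrite -natrX ler_nat ltnW// ltn_expl.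
  have e1 : 3 / 2 / e < n%:R.
    by rewrite (lt_le_trans (truncnS_gt _))// ler_nat.
  rewrite ltr_pdivrMr ?exprn_gt0// [X in _ < X]mulrC -ltr_pdivrMr//.
  exact: lt_le_trans n3.
have [|x xP] := @hilbert_complete_seq _ _ E s.
  move=> q e qA e0; have [N NP] := g_small e e0.
  by exists N => n m Nn nm; apply: le_lt_trans (NP n Nn); exact: smn'.
exists x => n.
(* The tail after s_(n+1) is at most (3/2) 3^-(n+1) = 1 / (2 3^n) in every seminorm. So f_n loses at
   most half of 3^-n M_n from the guaranteed two thirds, leaving one sixth. *)
have xU : unit_ball ((2 * 3 ^+ n) *~: (x - s n.+1)).
  move=> q qA; rewrite (seminormEZR qA.1) ger0_norm ?mulr_ge0 ?exprn_ge0//.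
  have : seminormE q (x - s n.+1) <= 3 / 2 * 3 ^- n.+1.
    apply/ler_addgt0Pr => e e0; have [N NP] := xP q e qA e0.
    have -> : x - s n.+1 = (s (maxn n.+1 N) - s n.+1) - (s (maxn n.+1 N) - x) by abelian.
    rewrite (le_trans (seminormEB qA.1 (hilbert_cauchy_schwarz qA.1) _ _))// lerD//.
      by apply: smn' => //; exact: leq_maxl.
    by apply: ltW; apply: NP; exact: leq_maxr.
  rewrite exprS invfM => h.
  rewrite (_ : 3 / 2 * (3^-1 * 3 ^- n) = (2 * 3 ^+ n)^-1) in h.
    by rewrite mulrC -ler_pdivlMr ?mul1r// mulr_gt0// exprn_gt0.
  by rewrite invfM mulrA (_ : 3 / 2 / 3 = 2^-1)//; field.
have := fM n _ xU; rewrite fZ ger0_norm ?mulr_ge0 ?exprn_ge0// => fx.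
have {}fx : f n (x - s n.+1) <= 3 ^- n / 2 * M n.
  have g1 : 0 < 2 * 3 ^+ n :> R by rewrite mulr_gt0// exprn_gt0.
  have -> : 3 ^- n / 2 * M n = M n / (2 * 3 ^+ n) by rewrite mulrC invfM [3 ^- n / 2]mulrC.
  by rewrite ler_pdivlMr// mulrC.
have fsn : f n (s n.+1) <= f n x + f n (x - s n.+1).
  have {1}-> : s n.+1 = x + - (x - s n.+1) by abelian.
  by rewrite -[X in _ <= _ + X]fN.
have := fs n; have := ler_wpM2l (ltW (g0 n)) (fw n).
by move: fx fsn; move: (3 ^- n) (f n (s n.+1)) => u v; lra.
Qed.

(** The hump argument needs functions already bounded on the unit ball. The maps p(<y, T x>) divided
    by the seminorm of y are, via the adjoint of [T]; taking y = T v recovers the size of T v. *)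
Lemma bounded_on_unit_ball T p : cstar_seminorms A p ->
  exists2 c, 0 <= c & forall x, unit_ball x -> seminormE p (op T x) <= c.
Proof.
move=> pA; apply: contrapT => unb.
have pP := pA.1; have CS : cauchy_schwarz E p := hilbert_cauchy_schwarz pP.
have large c : exists2 v, unit_ball v & c < seminormE p (op T v).
  apply: contrapT => nv; apply: unb; exists `|c| => // x xU.
  rewrite leNgt; apply/negP => cx; apply: nv; exists x => //.
  by rewrite (le_lt_trans _ cx)// ler_norm.
have hump (B : nat) : exists g : (E -> R) * E * R, [/\
    forall x, g.1.1 x <= seminormE p (op T x),
    forall x y, g.1.1 (x + y) <= g.1.1 x + g.1.1 y,
    forall r x, g.1.1 (r *~: x) = `|r| * g.1.1 x,
    unit_ball g.1.2 &
    [/\ forall x, unit_ball x -> g.1.1 x <= g.2, 2 / 3 * g.2 <= g.1.1 g.1.2 & B%:R <= g.2]].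
  have [v vU vB] := large B%:R; set y := op T v in vB.
  have y0 : 0 < seminormE p y by rewrite (le_lt_trans _ vB).
  pose f x := p (inner y (op T x)) / seminormE p y.
  have fT x : f x <= seminormE p (op T x) by rewrite ler_pdivrMr// mulrC; exact: CS.
  have fD x z : f (x + z) <= f x + f z.
    by rewrite /f -mulrDl ler_pM2r ?invr_gt0// opD innerDr; exact: (cstarD pP).
  have fZ r x : f (r *~: x) = `|r| * f x.
    by rewrite /f opZ innerZr (cstarZR pP) mulrA.
  have fv : f v = seminormE p y.
    by rewrite /f -/y -(seminormE_sqr pP) expr2 mulfK// gt_eqF.
  have fb : has_ubound [set f x | x in unit_ball].
    exists (seminormE p (op (astar T) y) / seminormE p y) => _ [x xU <-].
    rewrite /f inner_opr ler_pM2r ?invr_gt0// (le_trans (CS _ _))//.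
    by rewrite ler_piMr ?seminormE_ge0//; exact: xU.
  have fs : has_sup [set f x | x in unit_ball] by split=> //; exists (f v), v.
  set M := sup [set f x | x in unit_ball].
  have fM x : unit_ball x -> f x <= M by move=> xU; apply: ub_le_sup => //; exists x.
  have BM : B%:R < M by rewrite (lt_le_trans vB)// -fv fM.
  have M0 : 0 < M / 3 by rewrite divr_gt0// (le_lt_trans _ BM).
  have [_ [w wU <-] Mw] := sup_adherent M0 fs; rewrite -/M in Mw.
  exists (f, w, M); split=> //=; split=> //; last exact: ltW.
  by lra.
(* The factor cancels 3^-n / 6, so the limit vector x has T x of seminorm at least n for every n. *)
have /choice[g gP] n := hump (6 * 3 ^ n * n)%N.
have [||||| x xP] := @gliding_hump (fun n => (g n).1.1) (fun n => (g n).1.2) (fun n => (g n).2).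
- by move=> n; case: (gP n).
- by move=> n; case: (gP n).
- by move=> n; case: (gP n).
- by move=> n; case: (gP n) => _ _ _ _ [].
- by move=> n; case: (gP n) => _ _ _ _ [].
pose n := (Num.truncn (seminormE p (op T x))).+1.
have : n%:R <= seminormE p (op T x).
  case: (gP n) => gT _ _ _ [_ _ gB]; apply: le_trans (gT x); apply: le_trans (xP n).
  have g0 : 0 < 3 ^- n / 6 :> R by rewrite divr_gt0// invr_gt0 exprn_gt0.
  apply: le_trans (ler_wpM2l (ltW g0) gB).
  rewrite !natrM natrX; have h0 : 3 ^+ n != 0 :> R by rewrite expf_neq0.
  by move: (3 ^+ n) h0 => u u0; rewrite (_ : _ * _ = n%:R)//; field.
by apply/negP; rewrite -ltNge; exact: truncnS_gt.
Qed.

(* Any x with p(x) <= 1 is x' (1 + <x,x>) with x' in the unit ball of all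
   seminorms simultaneously. *)
Lemma operator_bounded T : obounded T.
Proof.
move=> p pA; have [c c0 Tc] := bounded_on_unit_ball T pA.
have pP := pA.1; have CS : cauchy_schwarz E p := hilbert_cauchy_schwarz pP.
exists (2 * c); first by rewrite mulr_ge0.
have T1 x : seminormE p x <= 1 -> seminormE p (op T x) <= 2 * c.
  move=> x1; have [Q HQ] := resolvent_ex (opositive_theta x) (obounded_theta x x).
  set x' := op Q x.
  have x'h q : cstar_seminorms A q -> seminormE q x' <= 2^-1.
    by move=> qA; apply: (seminormE_resolvent HQ) => //; rewrite subrr; exact: opositive0.
  have xE : x = x' + ract x (inner x x') by rewrite {1}(resolvent_apply HQ x).
  have x'U : unit_ball x' by move=> q /x'h; lra.
  have h1 := Tc _ x'U.
  (* The last factor is at most 1/2, so the second term is absorbed on the left; this is the origin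
     of 2 c. *)
  have h2 : seminormE p (op T x) <= seminormE p (op T x') + seminormE p (op T x) * p (inner x x').
    rewrite {1}xE opD op_ract (le_trans (seminormED pP CS _ _))// lerD2l.
    exact: (seminormE_ract pP).
  have h3 : p (inner x x') <= 2^-1.
    rewrite (le_trans (CS _ _))//; have := x'h p pA; have := seminormE_ge0 (p := p) x'.
    have := seminormE_ge0 (p := p) x; nra.
  have := seminormE_ge0 (p := p) (op T x); nra.
have scaled t x : 0 <= t -> t * seminormE p x <= 1 -> t * seminormE p (op T x) <= 2 * c.
  move=> t0 tx; have := T1 (t *~: x); rewrite opZ !(seminormEZR pP) ger0_norm//; exact.
move=> x; have [x0|x0] := eqVneq (seminormE p x) 0.
  rewrite x0 mulr0 leNgt; apply/negP => Tx0.
  (* On a null vector every scaling is admissible, so a nonzero image would violate the bound 2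
     c. *)
  have t0 : 0 <= (2 * c + 1) / seminormE p (op T x) by rewrite divr_ge0 ?seminormE_ge0//; lra.
  have := scaled _ x t0; rewrite x0 mulr0 mulfVK ?gt_eqF// => /(_ ler01); lra.
have x1 : 0 < seminormE p x by rewrite lt_neqAle eq_sym x0 seminormE_ge0.
have := scaled (seminormE p x)^-1 x; rewrite invr_ge0 mulVf// => /(_ (ltW x1) (lexx _)).
by rewrite mulrC ler_pdivrMr.
Qed.

Lemma bnd_opnorm T p : cstar_seminorms A p -> bnd p T (opnorm p T).
Proof.
move=> pA; have pP := pA.1; have [c c0 Tc] := operator_bounded T pA; move=> x.
have [x0|x0] := eqVneq (seminormE p x) 0.
  by have := Tc x; rewrite x0 !mulr0.
have x1 : 0 < seminormE p x by rewrite lt_neqAle eq_sym x0 seminormE_ge0.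
rewrite -ler_pdivrMr//; apply: ub_le_sup.
  by exists c => _ [y /= y1 <-]; rewrite (le_trans (Tc y))// ler_piMr.
exists ((seminormE p x)^-1 *~: x) => /=.
  by rewrite (seminormEZR pP) gtr0_norm ?invr_gt0// mulVf.
by rewrite opZ (seminormEZR pP) gtr0_norm ?invr_gt0// mulrC.
Qed.

Lemma opnorm_ge0 T p : cstar_seminorms A p -> 0 <= opnorm p T.
Proof.
move=> pA; have [c c0 Tc] := operator_bounded T pA.
apply: ub_le_sup.
  by exists c => _ [y /= y1 <-]; rewrite (le_trans (Tc y))// ler_piMr.
by exists 0 => /=; rewrite ?op0 (seminormE0 pA.1).
Qed.

Lemma opnorm_cstar_seminorm p B : cstar_seminorms A p ->
  continuous_cstar_seminorms B (opnorm p : operator E -> R).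
Proof.
move=> pA; have pP := pA.1; have CS : cauchy_schwarz E p := hilbert_cauchy_schwarz pP.
have n0 T := opnorm_ge0 T pA; have bn T := @bnd_opnorm T p pA.
have le T c : 0 <= c -> bnd p T c -> opnorm p T <= c by exact: opnorm_le.
have nZ (c : R[i]) T : opnorm p (c *: T) <= Normc.normc c * opnorm p T.
  apply: le; last exact: (bndZ pP).
  by rewrite mulr_ge0//; case: c => x y /=; exact: sqrtr_ge0.
split; first split.
- by move=> S T _ _; apply: le; [exact: addr_ge0|exact: (bndD pP CS)].
(* The reverse inequality is the same estimate for c^-1 applied to c T. *)
- move=> c T _; apply/eqP; rewrite eq_le nZ/=.
  have [->|c0] := eqVneq c 0; first by rewrite Normc.normc0 mul0r.
  have c1 : 0 < Normc.normc c.
    rewrite lt_neqAle eq_sym; apply/andP; split.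
      by apply/eqP => /Normc.eq0_normc/eqP; apply/negP.
    by case: (c) => x y /=; exact: sqrtr_ge0.
  have := nZ c^-1 (c *: T); rewrite scalerA mulVf// scale1r Normc.normcV.
  by rewrite mulrC ler_pdivlMr// mulrC.
- by move=> S T _ _; apply: le; [exact: mulr_ge0|exact: bndM].
- move=> T _; apply/eqP; rewrite eq_le; apply/andP; split.
    apply: le; first exact: sqr_ge0.
    by rewrite expr2; apply: bndM => //; exact: (bnd_star pP CS).
  have : opnorm p T <= Num.sqrt (opnorm p (astar T ** T)).
    by apply: le; [exact: sqrtr_ge0|apply: (bnd_cstar pP CS); rewrite ?sqrtr_ge0// sqr_sqrtr].
  by rewrite -(ler_pXn2r (n := 2))// ?nnegrE ?sqrtr_ge0// sqr_sqrtr.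
apply: continuous_subspaceT => T.
apply/(@cvgrPdist_lt _ _ _ (nbhs (T : operator E)) (nbhs_filter _)) => e e0.
have : opnorm p (T - T) < e.
  by rewrite subrr (le_lt_trans (le 0 0 _ _))//; exact: (bnd0 pP).
move=> /(nbhs_opball pA); apply: filterS => T' /= T'e.
have := opnormD_le T pP (n0 _) (bn (T' - T)).
have := opnormD_le T' pP (n0 _) (bn (T - T')).
rewrite -[in opnorm p (T - T')]opprB opnormN//.
have -> : T + (T' - T) = T' by abelian.
have -> : T' + (T - T') = T by abelian.
by rewrite ltr_norml => ? ?; apply/andP; split; lra.
Qed.

End Boundedness.

(** * Countable generation *)

Section Frechet.
Context {R : realType} {A : locallyCstarType R} {E : hilbertModType A}.
Implicit Types (p q : A -> R) (x y z : E) (T F : operator E) (c d e r : R).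

Local Notation K := (compact_operators E).
Local Notation submodule := (@submodule R A E).

Lemma finite_rank_range F : finite_rank E F -> exists2 X : set E, countable X &
  forall M, submodule M -> X `<=` M -> forall z, M (op F z).
Proof.
move=> [n [c [x [y ->]]]]; exists (range x).
  by apply: sub_countable (card_image_le _ _) _; exact: countableP.
move=> M [M0 MD MZ MA] XM z; rewrite opsum; apply: big_ind => // i _.
by rewrite opscale thetaE; apply: MZ; apply: MA; apply: XM; exists i.
Qed.

(** The countable family describes the topology of A only, so convergence is transferred through the
    elements <u_n, u_n> before an arbitrary seminorm is tested. *)
Lemma frechet_cvg (P : set (A -> R)) (u : nat -> E) p d :
  P `<=` cstar_seminorms A -> topology_given_by P ->
  (forall q, P q -> exists N c, forall n, (N <= n)%N -> seminormE q (u n) <= c / n.+1%:R) ->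
  cstar_seminorms A p -> 0 < d -> exists n, seminormE p (u n) < d.
Proof.
move=> PA topP uP pA d0.
have : (fun n => inner (u n) (u n) : A) @ \oo --> (0 : A).
  apply/topP => q Pq; have qP := (PA q Pq).1; apply/cvgr0Pnorm_lt => e e0.
  have [N [c uc]] := uP q Pq.
  have e1 : 0 < Num.sqrt e by rewrite sqrtr_gt0.
  exists (maxn N (Num.truncn (c / Num.sqrt e)).+1) => // n; rewrite /= geq_max => /andP[Nn en].
  rewrite ger0_norm ?(cstar_ge0 qP)// -(seminormE_sqr qP) -(sqr_sqrtr (ltW e0)).
  rewrite ltr_pXn2r ?nnegrE ?seminormE_ge0 ?sqrtr_ge0//.
  apply: le_lt_trans (uc n Nn) _; rewrite ltr_pdivrMr// mulrC -ltr_pdivrMr//.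
  by rewrite (lt_le_trans (truncnS_gt _))// ler_nat ltnW.
have d2 : 0 < d ^+ 2 by rewrite exprn_gt0.
move=> /(@locally_cstar_topology R A _ _).1/(_ p pA)/cvgr0Pnorm_lt/(_ _ d2)[N _ /(_ N (leqnn _))].
rewrite /= ger0_norm ?(cstar_ge0 pA.1)// -(seminormE_sqr pA.1).
by rewrite ltr_pXn2r ?nnegrE ?seminormE_ge0 ?(ltW d0)// => ?; exists N.
Qed.

(** A neighbourhood controls finitely many seminorms only; the injection [g] selects those with code
    below n. *)
Lemma countable_seminorms_nbhs (P : set (A -> R)) (g : (A -> R) -> nat) T n d :
  P `<=` cstar_seminorms A -> {in P &, injective g} -> 0 < d ->
  nbhs T [set T' | forall p, P p -> (g p < n)%N -> opnorm p (T' - T) < d].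
Proof.
move=> PA gI d0; elim: n => [|n IH]; first by apply: filterS filterT.
have [[q [Pq gq]]|nq] := pselect (exists q, P q /\ g q = n); last first.
  apply: filterS IH => T' H p Pp; rewrite ltnS leq_eqVlt => /orP[/eqP gp|]; last exact: H.
  by exfalso; apply: nq; exists p.
have : opnorm q (T - T) < d.
  rewrite subrr (le_lt_trans (opnorm_le (PA q Pq).1 (lexx 0) _))//.
  exact: (bnd0 (PA q Pq).1).
move=> /(nbhs_opball (PA q Pq)) Hq; apply: filterS (filterI IH Hq) => T' [H1 H2] p Pp.
rewrite ltnS leq_eqVlt => /orP[/eqP gp|]; last exact: H1.
by rewrite (_ : p = q)//; apply: gI; rewrite ?inE// gp.
Qed.

Lemma unit_countably_generated : frechet A -> has_countable_approximate_unit K ->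
  countably_generated E.
Proof.
move=> [P [/countable_injP[g gI] PA topP]] [I [le [e [cI eU]]]].
have /choice[X XP] (j : I * nat) : exists X : set E, countable X /\ exists2 F : operator E,
    (forall M, submodule M -> X `<=` M -> forall z, M (op F z)) &
    forall p, P p -> (g p < j.2)%N -> opnorm p (F - e j.1) < j.2.+1%:R^-1.
  have Ke : K (e j.1) := approximate_unit_in eU j.1.
  have j0 : 0 < j.2.+1%:R^-1 :> R by rewrite invr_gt0.
  have [F [fF FP]] := Ke _ (countable_seminorms_nbhs (e j.1) j.2 PA gI j0).
  have [Y cY YP] := finite_rank_range fF.
  by exists Y; split=> //; exists F.
exists (\bigcup_(i in [set: I]) \bigcup_(n in [set: nat]) X (i, n)); split.
  apply: bigcup_countable => // i _; apply: bigcup_countable => // n _.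
  exact: (XP (i, n)).1.
apply/seteqP; split=> // z _ M [[sM cM] XM].
have [M0 MD MZ MA] := sM.
have Me i y : M (op (e i) y).
  apply: (closed_seminormE cM) => p d pA d0.
  have /choice[F FP] n : exists F : operator E, M (op F y) /\
      forall p, P p -> (g p < n)%N -> opnorm p (F - e i) < n.+1%:R^-1.
    have [_ [F MF Fe]] := XP (i, n); exists F; split=> //.
    by apply: MF => // x Xx; apply: XM; exists i => //; exists n.
  pose u n := op (F n) y - op (e i) y.
  have [|n un] := @frechet_cvg P u p d PA topP _ pA d0.
    (* Diagonal choice: from n > g q on, [q] is among the seminorms controlled by the n-th
       approximant. *)
    move=> q Pq; exists (g q).+1, (seminormE q y) => n gn.
    have := @bnd_opnorm _ _ E (F n - e i) q (PA q Pq) y; move=> /le_trans; apply.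
    rewrite mulrC ler_wpM2l ?seminormE_ge0// ltW//.
    by apply: (FP n).2.
  by exists (op (F n) y) => //; exact: (FP n).1.
have Mtheta y : M (op (theta z z) y).
  apply: (closed_seminormE cM) => p d pA d0.
  have y1 : 0 < seminormE p y + 1 by have := seminormE_ge0 (p := p) y; lra.
  have Kt : K (theta z z) by apply: finite_rank_compact; exact: finite_rank_theta.
  have [_ ] := approximate_unit_cvg eU (opnorm_cstar_seminorm (E := E) K pA) Kt.
  have FF : Filter (tails le).
    have [[i0] lexx le_trans leU] := approximate_unit_directed eU.
    apply: filter_from_filter; first by exists i0.
    move=> i j _ _; have [k [ik jk]] := leU i j; exists k => // l kl.
    by split; [exact: le_trans ik kl|exact: le_trans jk kl].
  move=> /cvgr0Pnorm_lt/(_ _ (divr_gt0 d0 y1))[i _ /(_ i) /=].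
  have [_ lexx _ _] := approximate_unit_directed eU => /(_ (lexx i)).
  rewrite ger0_norm; last exact: opnorm_ge0.
  move=> h; exists (op (e i) (op (theta z z) y)) => //.
  have := @bnd_opnorm _ _ E (e i ** theta z z - theta z z) p pA y; move=> /le_lt_trans; apply.
  apply: le_lt_trans (ler_wpM2r (seminormE_ge0 y) (ltW h)) _.
  by rewrite mulrAC ltr_pdivrMr// ltr_pM2l//; lra.
(* Part 1 is reused for the constant sequence z, where h_n = n^2 [theta z z]: Q_n z tends to 0 and z
   - Q_n z = h_n Q_n z lies in [M]. *)
have /choice[Q HQ] n : exists Q, resolvent_of (gensum (fun=> z) n) Q.
  by apply: resolvent_ex; [exact: opositive_gensum|exact: obounded_gensum].
apply: (closed_seminormE cM) => p d pA d0.
have d2 : 0 < d / 2 by rewrite divr_gt0.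
have [N NP] := vanishes_gen HQ 0%N pA d2.
exists (op (gensum (fun=> z) N) (op (Q N) z)).
  rewrite opsum; apply: big_ind => // k _.
  by rewrite opscale; apply: MZ; exact: Mtheta.
have -> : op (gensum (fun=> z) N) (op (Q N) z) - z = - op (Q N) z.
  have h := resolvent_apply (HQ N) z.
  have -> : op (gensum (fun=> z) N) (op (Q N) z) = z - op (Q N) z.
    by apply: (addrI (op (Q N) z)); rewrite -h addrC subrK.
  abelian.
rewrite (seminormEN pA.1); have := NP N (leqnn _) => /le_lt_trans; apply; lra.
Qed.

End Frechet.

Theorem proposition4p5 (R : realType) (A : locallyCstarType R)
    (E : hilbertModType A) :
  (countably_generated E ->
     has_countable_approximate_unit (compact_operators E)) /\
  (frechet A -> has_countable_approximate_unit (compact_operators E) ->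
     countably_generated E).
Proof.
by split; [exact: countably_generated_unit|exact: unit_countably_generated].
Qed.
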